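(* Let $d\ge 1$ be an integer and let $S_{d-1}$ denote the $(d-1)$-dimensional unit sphere in $\mathbb{R}^d$. For every non-empty compact set $R \subseteq (0,\infty)$, $$\dim_F(RS_{d-1}) \geq \dim_F(R) + \dim_F(S_{d-1}).$$
   Context: Here $RS_{d-1} = \{ry : r\in R,\ y\in S_{d-1}\}\subseteq \mathbb{R}^d$. For $A \subseteq \mathbb{R}^n$, $\mathcal{M}(A)$ is the set of non-zero finite Borel measures on $\mathbb{R}^n$ with compact support contained in $A$. The Fourier transform is $\widehat{\mu}(\xi) = \int e^{-2\pi i x\cdot\xi}\,d\mu(x)$. The Fourier dimension of a Borel set $A \subseteq \mathbb{R}^n$ is $\dim_F(A) = \sup\{0<s<n : \sup_{\xi\in\mathbb{R}^n} |\widehat{\mu}(\xi)|^2|\xi|^s < \infty \text{ for some } \mu\in\mathcal{M}(A)\}$, with the supremum of the empty set taken to be $0$. In the claim, $\dim_F(R)$ is computed in $\mathbb{R}$ ($n=1$), while $\dim_F(RS_{d-1})$ and $\dim_F(S_{d-1})$ are computed in $\mathbb{R}^d$ ($n=d$). It is a known fact that $\dim_F(S_{d-1}) = d-1$. *)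

(* Defs.v *)
From HB Require Import structures.
From mathcomp Require Import all_boot all_order all_algebra.
From mathcomp Require Import complex.
From mathcomp Require Import all_classical all_reals all_analysis.
Set Implicit Arguments.
Unset Strict Implicit.
Unset Printing Implicit Defensive.
Import Order.TTheory GRing.Theory Num.Theory.
Import numFieldNormedType.Exports.
Local Open Scope classical_set_scope.
Local Open Scope ring_scope.
Local Open Scope complex_scope.

Definition dotp (K : realType) (n : nat) (x y : 'rV[K]_n) : K :=
  \sum_(i < n) x 0 i * y 0 i.

(* The library norm `|x| on 'rV[K]_n is the sup norm; it induces the same
   topology, but the Euclidean norm has to be defined separately. *)
Definition enorm (K : realType) (n : nat) (x : 'rV[K]_n) : K :=
  Num.sqrt (dotp x x).

Definition unit_sphere (K : realType) (n : nat) : set 'rV[K]_n :=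
  [set y | enorm y = 1].

Definition radial_product (K : realType) (n : nat) (A : set K)
    (S : set 'rV[K]_n) : set 'rV[K]_n :=
  [set r *: y | r in A & y in S].

Definition line_set (K : realType) (A : set K) : set 'rV[K]_1 :=
  [set x | A (x 0 0)].

Definition borel_rV (K : realType) (n : nat) :=
  g_sigma_algebraType (@open 'rV[K]_n).

Definition borel_measure (K : realType) (n : nat) :=
  {finite_measure set (borel_rV K n) -> \bar K}.

Definition msupport (K : realType) (n : nat) (mu : borel_measure K n) :
    set 'rV[K]_n :=
  [set x | forall U : set 'rV[K]_n, open U -> U x -> (0 < mu U)%E].

(* Membership of mu in M(A). *)
Definition carried_by (K : realType) (n : nat) (A : set 'rV[K]_n)
    (mu : borel_measure K n) : Prop :=
  [/\ mu [set: 'rV[K]_n] <> 0%E, compact (msupport mu) & msupport mu `<=` A].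

Definition expi (K : realType) (t : K) : K[i] := cos t +i* sin t.

(* Only applied below to bounded continuous f and finite mu, so that both
   real integrals are genuine. *)
Definition cintegral (K : realType) (n : nat) (mu : borel_measure K n)
    (f : 'rV[K]_n -> K[i]) : K[i] :=
  (\int[mu]_x complex.Re (f x)) +i* (\int[mu]_x complex.Im (f x)).

Definition fourier_transform (K : realType) (n : nat)
    (mu : borel_measure K n) (xi : 'rV[K]_n) : K[i] :=
  cintegral mu (fun x => expi (- (2 * pi * dotp x xi))).

Definition fourier_decay (K : realType) (n : nat)
    (mu : borel_measure K n) (s : K) : Prop :=
  (ereal_sup
     [set (ComplexField.Normc.normc (fourier_transform mu xi) ^+ 2 *
           enorm xi `^ s)%:E | xi in [set: 'rV[K]_n]] < +oo)%E.

(* The library's sup satisfies sup set0 = 0, and the set below is bounded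
   by n, so this is the real supremum with the usual convention. *)
Definition fourier_dim (K : realType) (n : nat) (A : set 'rV[K]_n) : K :=
  sup [set s : K | 0 < s < n%:R /\
         exists2 mu : borel_measure K n, carried_by A mu & fourier_decay mu s].

(* Main.v *)
(* Averaging a plane wave over a rotation-invariant measure sigma on the unit
   sphere of R^(n+1) gives a radial function J(|xi|) solving the Bessel equation
   J'' + (n/x) J' + J = 0. Hence g = x^(n/2) J solves g'' + (1 - m/x^2) g = 0, and
   an energy estimate yields g(x) = A cos x + B sin x + O(1/x) with (A, B) <> 0.
   Only this expansion is used, so the Bessel functions never appear explicitly.

   Lower bound: if mu on R satisfies |mu^(t)| = O(|t|^(-s/2)), then the image nu of
   r^(n/2) mu(dr) sigma(dy) under (r, y) |-> r y has
   nu^(xi) = |xi|^(-n/2) (A Re mu^ + B Im mu^)(|xi|) + O(|xi|^(-n/2-1))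
   up to constants, which is O(|xi|^(-(s+n)/2)).

   Upper bound dim_F (S_n) <= n: for mu on the sphere, averaging mu^ over the
   sphere of radius rho gives J(rho) mu(1) up to scaling, by Fubini; a decay
   exponent s > n would force g to tend to 0, contradicting (A, B) <> 0.

   The measure sigma is built by suspension: from S_n to S_(n+1) it is the image of
   |sin t|^n dt sigma(dy), t in [0, pi], under (t, y) |-> (cos t, sin t y). Its
   transform is radial because the derivative of the integral along a rotation
   of the frequency is, by the Bessel equation for J, the integral of a total
   t-derivative. *)

Require Import Defs.
From HB Require Import structures.
From mathcomp Require Import all_boot all_order all_algebra.
From mathcomp Require Import complex.
From mathcomp Require Import all_classical all_reals all_analysis.
From mathcomp Require Import measurable_realfun lebesgue_integral_under ring lra.
Set Implicit Arguments.
Unset Strict Implicit.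
Unset Printing Implicit Defensive.
Import Order.TTheory GRing.Theory Num.Theory.
Import numFieldNormedType.Exports.
Local Open Scope classical_set_scope.
Local Open Scope ring_scope.

(** * Oscillation of solutions of Bessel-type equations *)

Section pointwise_derivation.
Variables (K : realType) (x : K).
Implicit Types (f g : K -> K) (a b c : K).

Lemma deriv_cst c : is_derive x 1 (fun=> c) 0.
Proof. exact: is_derive_cst. Qed.

Lemma deriv_eq f (a b : K) : is_derive x 1 f a -> a = b -> is_derive x 1 f b.
Proof. by move=> + <-. Qed.

Lemma deriv_id : is_derive x 1 (fun x : K => x) 1.
Proof. exact: is_derive_id. Qed.

Lemma deriv_add f g a b : is_derive x 1 f a -> is_derive x 1 g b ->
  is_derive x 1 (fun x => f x + g x) (a + b).
Proof. by move=> ? ?; exact: is_deriveD. Qed.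

Lemma deriv_opp f a : is_derive x 1 f a -> is_derive x 1 (fun x => - f x) (- a).
Proof. by move=> ?; exact: is_deriveN. Qed.

Lemma deriv_mul f g a b : is_derive x 1 f a -> is_derive x 1 g b ->
  is_derive x 1 (fun x => f x * g x) (a * g x + f x * b).
Proof.
move=> ? ?; apply: (is_derive_eq (is_deriveM _ _)).
by rewrite /GRing.scale/= addrC [g x * _]mulrC.
Qed.

Lemma deriv_scale c f a : is_derive x 1 f a ->
  is_derive x 1 (fun x => c * f x) (c * a).
Proof.
move=> df; have := deriv_mul (deriv_cst c) df.
by move/deriv_eq; apply; rewrite mul0r add0r.
Qed.

Lemma deriv_comp f g a b : is_derive (f x) 1 g b -> is_derive x 1 f a ->
  is_derive x 1 (fun x => g (f x)) (b * a).
Proof. by move=> ? ?; exact: is_derive1_comp. Qed.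

Lemma deriv_cos f a : is_derive x 1 f a ->
  is_derive x 1 (fun x => cos (f x)) (- sin (f x) * a).
Proof. exact: deriv_comp. Qed.

Lemma deriv_sin f a : is_derive x 1 f a ->
  is_derive x 1 (fun x => sin (f x)) (cos (f x) * a).
Proof. exact: deriv_comp. Qed.

Lemma deriv_expR f a : is_derive x 1 f a ->
  is_derive x 1 (fun x => expR (f x)) (expR (f x) * a).
Proof. exact: deriv_comp. Qed.

Lemma deriv_inv f a : f x != 0 -> is_derive x 1 f a ->
  is_derive x 1 (fun x => (f x)^-1) (- a / f x ^+ 2).
Proof.
move=> fx0 ?; apply: (is_derive_eq (is_deriveV fx0 _)).
by rewrite /GRing.scale/= mulrC mulNr mulrN.
Qed.

Lemma deriv_exp f a n : is_derive x 1 f a ->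
  is_derive x 1 (fun x => f x ^+ n) (n%:R * f x ^+ n.-1 * a).
Proof.
move=> ?; have -> : (fun x => f x ^+ n) = f ^+ n by apply/funext => y; rewrite exprfctE.
exact: (is_derive_eq (is_deriveX n _)).
Qed.

End pointwise_derivation.

(* [apply:] would let instance resolution close the premises with derivatives
   in scaled form, which [ring] and [field] do not normalise. *)
Ltac derivs := repeat first [ eassumption
 | notypeclasses refine (deriv_cst _ _) | notypeclasses refine (deriv_id _)
 | notypeclasses refine (deriv_add _ _) | notypeclasses refine (deriv_opp _)
 | notypeclasses refine (deriv_exp _ _) | notypeclasses refine (deriv_mul _ _)
 | notypeclasses refine (deriv_cos _) | notypeclasses refine (deriv_sin _)
 | notypeclasses refine (deriv_expR _)
 | notypeclasses refine (deriv_inv _ _); [by [] | ] ].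
Tactic Notation "derive_by" tactic3(t) :=
  notypeclasses refine (deriv_eq _ _); [by derivs | move=> /=; t].

Lemma is_derive_nonincr (K : realType) (a : K) (f f' : K -> K) :
  (forall x, a <= x -> is_derive x 1 f (f' x)) ->
  (forall x, a <= x -> f' x <= 0) ->
  forall x y, a <= x -> x <= y -> f y <= f x.
Proof.
move=> df f'0; apply: ler0_derive1_nincry => [x|x|].
- by rewrite in_itv/= andbT => /ltW/df[].
- by rewrite in_itv/= andbT => /ltW ax; have := df x ax => ?; rewrite derive1E derive_val f'0.
- apply: derivable_within_continuous => x; rewrite in_itv/= andbT => /df[]//.
Qed.

Lemma is_derive_nondecr (K : realType) (a : K) (f f' : K -> K) :
  (forall x, a <= x -> is_derive x 1 f (f' x)) ->
  (forall x, a <= x -> 0 <= f' x) ->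
  forall x y, a <= x -> x <= y -> f x <= f y.
Proof.
move=> df f'0 x y ax xy; rewrite -lerN2.
apply: (@is_derive_nonincr _ a (fun x => - f x) (fun x => - f' x)) => //.
- by move=> z /df ?; apply: is_deriveN.
- by move=> z /f'0; rewrite oppr_le0.
Qed.

(** The derivative bound makes [f + C / x] nonincreasing and [f - C / x] nondecreasing. Every value
    of the second lies below every value of the first, so the supremum of the second lies between
    them at each point and serves as the limit [A]. *)
Lemma integrable_derivative_cvg (K : realType) (a C : K) (f f' : K -> K) :
  0 < a -> 0 <= C ->
  (forall x, a <= x -> is_derive x 1 f (f' x)) ->
  (forall x, a <= x -> `|f' x| <= C / x ^+ 2) ->
  exists A, forall x, a <= x -> `|f x - A| <= C / x.
Proof.
move=> a0 C0 df f'C.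
have gt0 x : a <= x -> 0 < x by exact: lt_le_trans.
have dV x : a <= x -> is_derive x 1 (fun x : K => C / x) (- (C / x ^+ 2)).
  move=> ax; have x0 : x != 0 by rewrite gt_eqF// gt0.
  by derive_by field.
have dn := @is_derive_nonincr _ a (fun x => f x + C / x) (fun x => f' x - C / x ^+ 2).
have nd := @is_derive_nondecr _ a (fun x => f x - C / x) (fun x => f' x + C / x ^+ 2).
have {}dn : forall x y, a <= x -> x <= y -> f y + C / y <= f x + C / x.
  apply: dn => x ax.
  - have := df _ ax; have := dV _ ax => ? ?; by derivs.
  - have := f'C _ ax; rewrite ler_norml => /andP[_]; lra.
have {}nd : forall x y, a <= x -> x <= y -> f x - C / x <= f y - C / y.
  apply: nd => x ax.
  - have := df _ ax; have := dV _ ax => ? ?; by derive_by ring.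
  - have := f'C _ ax; rewrite ler_norml => /andP[+ _]; lra.
(* Both monotone functions are compared at the larger of the two points. *)
have H x y : a <= x -> a <= y -> f x - C / x <= f y + C / y.
  move=> ax ay; have az : a <= Num.max x y by rewrite le_max ax.
  have := nd x (Num.max x y) ax; rewrite le_max lexx => /(_ isT) h1.
  have := dn y (Num.max x y) ay; rewrite le_max lexx orbT => /(_ isT) h2.
  have : 0 <= C / Num.max x y by rewrite divr_ge0// ltW// gt0.
  lra.
pose S := [set f x - C / x | x in [set x | a <= x]].
have S0 : S !=set0 by exists (f a - C / a), a => //=; exact: lexx.
exists (sup S) => x ax.
have h1 : f x - C / x <= sup S.
  apply: ub_le_sup; last by exists x.
  by exists (f a + C / a) => _ [y ay <-]; apply: H => //=; exact: lexx.
have h2 : sup S <= f x + C / x.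
  by apply: ge_sup => // _ [y ay <-]; exact: H.
rewrite ler_norml; lra.
Qed.

(** The energy [E = g^2 + g1^2] satisfies [|E'| <= (|m| / x^2) E], so it stays bounded and bounded
    away from 0. In the rotating frame the coordinates [g cos - g1 sin] and [g sin + g1 cos] have
    derivatives [O(1 / x^2)], hence limits [A] and [B]. Their squares add up to [E], which rules out
    [A = B = 0]. *)
Lemma oscillation_asymptotics (K : realType) (m a : K) (g g1 : K -> K) :
  0 < a -> g a != 0 ->
  (forall x, a <= x -> is_derive x 1 g (g1 x)) ->
  (forall x, a <= x -> is_derive x 1 g1 (- g x + m / x ^+ 2 * g x)) ->
  exists A B C, [/\ 0 <= C, (A != 0) || (B != 0) &
    forall x, a <= x -> `|g x - (A * cos x + B * sin x)| <= C / x].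
Proof.
move=> a0 ga dg dg1.
have gt0 x : a <= x -> 0 < x by exact: lt_le_trans.
pose M := `|m|; have M0 : 0 <= M by exact: normr_ge0.
pose E x := g x ^+ 2 + g1 x ^+ 2.
have E0 x : 0 <= E x by rewrite addr_ge0// sqr_ge0.
pose E' x := 2 * (m / x ^+ 2) * g x * g1 x.
have dE x : a <= x -> is_derive x 1 E (E' x).
  move=> ax; have := dg _ ax; have := dg1 _ ax => ? ?.
  by rewrite /E; derive_by (rewrite /E'; ring).
have E'E x : a <= x -> `|E' x| <= M / x ^+ 2 * E x.
  move=> ax; have x0 := gt0 _ ax.
  rewrite /E' -!mulrA !normrM normfV (ger0_norm (sqr_ge0 x)) -/M.
  rewrite [`|2|]ger0_norm// mulrCA; apply: ler_wpM2l => //.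
  rewrite mulrCA; apply: ler_wpM2l; first by rewrite invr_ge0 sqr_ge0.
  rewrite /E -[g x ^+ 2]real_normK ?num_real// -[g1 x ^+ 2]real_normK ?num_real//.
  have := sqr_ge0 (`|g x| - `|g1 x|); rewrite sqrrB; lra.
(* Integrating factors: [s = 1] makes [E] times the factor nonincreasing, [s = -1] makes it
   nondecreasing. *)
have de s x : a <= x -> is_derive x 1 (fun x : K => expR (s * (M / x)))
    (- (s * M / x ^+ 2) * expR (s * (M / x))).
  move=> ax; have x0 : x != 0 by rewrite gt_eqF// gt0.
  by derive_by field.
have up x : a <= x -> E x <= E a * expR (M / a).
  move=> ax.
  have := @is_derive_nonincr _ a (fun x => E x * expR (1 * (M / x)))
   (fun x => (E' x - M / x ^+ 2 * E x) * expR (1 * (M / x))) _ _ a x.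
  rewrite !mul1r => H; apply: le_trans (H _ _ _ _) => //.
  - rewrite ler_peMr// -expR0 ler_expR divr_ge0// ltW// gt0//.
  - move=> y ay; have := dE _ ay; have := de 1 _ ay => ? ?.
    by derive_by ring.
  - move=> y ay; rewrite pmulr_lle0 ?expR_gt0//.
    by have := E'E _ ay; rewrite ler_norml => /andP[_]; rewrite subr_le0.
have lo x : a <= x -> E a * expR (- (M / a)) <= E x.
  move=> ax.
  have := @is_derive_nondecr _ a (fun x => E x * expR (-1 * (M / x)))
   (fun x => (E' x + M / x ^+ 2 * E x) * expR (-1 * (M / x))) _ _ a x.
  rewrite !mulN1r => H; apply: (le_trans (H _ _ _ _)) => //.
  - move=> y ay; have := dE _ ay; have := de (-1) _ ay => ? ?.
    by derive_by ring.
  - move=> y ay; rewrite pmulr_lge0 ?expR_gt0//.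
    by have := E'E _ ay; rewrite ler_norml => /andP[+ _]; lra.
  - rewrite ler_piMr// -[leRHS]expR0 ler_expR oppr_le0 divr_ge0// ltW// gt0//.
pose D := Num.sqrt (E a * expR (M / a)).
have gD x : a <= x -> `|g x| <= D.
  move=> ax; rewrite -sqrtr_sqr ler_sqrt ?mulr_ge0 ?expR_ge0//.
  by apply: le_trans (up _ ax); rewrite lerDl sqr_ge0.
have D0 : 0 <= D by exact: sqrtr_ge0.
have bnd (h : K -> K) x : a <= x -> `|h x| <= 1 -> `|m / x ^+ 2 * g x * h x| <= (M * D) / x ^+ 2.
  move=> ax h1; rewrite !normrM normfV (ger0_norm (sqr_ge0 x)) -/M.
  rewrite -!mulrA; apply: ler_wpM2l => //; rewrite [leRHS]mulrC.
  apply: ler_wpM2l; first by rewrite invr_ge0 sqr_ge0.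
  by rewrite -[leRHS]mulr1 ler_pM// gD.
have cos1 (x : K) : `|cos x| <= 1 by rewrite ler_norml cos_geN1 cos_le1.
have sin1 (x : K) : `|sin x| <= 1 by rewrite ler_norml sin_geN1 sin_le1.
have MD0 : 0 <= M * D by rewrite mulr_ge0.
have [||A HA] := @integrable_derivative_cvg _ a (M * D) (fun x => g x * cos x - g1 x * sin x)
  (fun x => m / x ^+ 2 * g x * - sin x) a0 MD0.
- move=> x ax; have := dg _ ax; have := dg1 _ ax => ? ?.
  by derive_by ring.
- by move=> x ax; apply: (@bnd (fun x => - sin x)) => //; rewrite normrN.
have [||B HB] := @integrable_derivative_cvg _ a (M * D) (fun x => g x * sin x + g1 x * cos x)
  (fun x => m / x ^+ 2 * g x * cos x) a0 MD0.
- move=> x ax; have := dg _ ax; have := dg1 _ ax => ? ?.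
  by derive_by ring.
- by move=> x ax; exact: (@bnd cos).
exists A, B, (2 * (M * D)); split.
- by rewrite mulr_ge0.
- apply/negP => /negP; rewrite negb_or !negbK => /andP[/eqP A0 /eqP B0].
  have Ea : 0 < E a by rewrite ltr_wpDr ?sqr_ge0// exprn_even_gt0.
  pose e := E a * expR (- (M / a)); have e0 : 0 < e by rewrite mulr_gt0// expR_gt0.
  (* If both limits were 0, then [E x <= 2 (M D)^2 / x^2]. Since this [x] is at least 1 and exceeds
     [2 (M D)^2 / e], that value is below the lower bound [e] of the energy. *)
  pose x := a + 1 + 2 * (M * D) ^+ 2 / e.
  have q0 : 0 <= 2 * (M * D) ^+ 2 / e.
    by rewrite !mulr_ge0 ?invr_ge0 ?sqr_ge0// ltW.
  have ax : a <= x by rewrite /x; lra.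
  have x1 : 1 <= x by rewrite /x; lra.
  have := HA _ ax; have := HB _ ax; rewrite A0 B0 !subr0 => hv hu.
  have := lo _ ax; apply/negP; rewrite -ltNge -/e.
  have -> : E x = `|g x * cos x - g1 x * sin x| ^+ 2 + `|g x * sin x + g1 x * cos x| ^+ 2.
    rewrite !real_normK ?num_real// /E.
    transitivity ((g x ^+ 2 + g1 x ^+ 2) * (cos x ^+ 2 + sin x ^+ 2)); last by ring.
    by rewrite cos2Dsin2 mulr1.
  have sq (u : K) : `|u| <= M * D / x -> `|u| ^+ 2 <= (M * D) ^+ 2 / x ^+ 2.
    by move=> h; rewrite -expr_div_n lerXn2r ?nnegrE// (le_trans _ h).
  apply: (le_lt_trans (lerD (sq _ hu) (sq _ hv))).
  rewrite -mulr2n -[_ *+ 2]mulr_natl mulrA ltr_pdivrMr ?exprn_gt0 ?(lt_le_trans ltr01)//.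
  have : 2 * (M * D) ^+ 2 < e * x.
    by rewrite [e * x]mulrC -ltr_pdivrMr// /x; lra.
  move=> /lt_le_trans; apply; rewrite ler_pM2l// expr2 ler_peMl//.
  by rewrite (le_trans ler01).
move=> x ax.
(* Rotating back recovers [g] from its two rotating coordinates. *)
have -> : g x - (A * cos x + B * sin x) =
  (g x * cos x - g1 x * sin x - A) * cos x + (g x * sin x + g1 x * cos x - B) * sin x.
  transitivity (g x * (cos x ^+ 2 + sin x ^+ 2) - (A * cos x + B * sin x)); last by ring.
  by rewrite cos2Dsin2 mulr1.
apply: (le_trans (ler_normD _ _)).
have -> : 2 * (M * D) / x = M * D / x * 1 + M * D / x * 1 by ring.
by rewrite !normrM; apply: lerD; apply: ler_pM => //; [exact: HA|exact: HB].
Qed.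

(** * Borel measures on row vectors *)

(** The index type is countable, so these cubes form a countable base of the topology. Arguments
    about arbitrary open sets become countable unions. *)
Definition rat_ball (K : realType) (n : nat) (p : 'rV[rat]_n * nat) :
  set 'rV[K]_n := [set x | forall i, `|x 0 i - ratr (p.1 0 i)| < p.2.+1%:R^-1].

Lemma rat_ball_basis (K : realType) (n : nat) (U : set 'rV[K]_n) x :
  open U -> U x -> exists p, @rat_ball K n p x /\ @rat_ball K n p `<=` U.
Proof.
move=> oU Ux.
have /nbhs_ballP[e /= e0 eU] : nbhs x U by exact: open_nbhs_nbhs.
have [k _ kE] := near_infty_natSinv_lt (PosNum (divr_gt0 e0 (ltr0Sn K 1))).
have {}kE : (k.+1%:R : K)^-1 < e / 2 by have := kE k (leqnn k).
have k0 : 0 < (k.+1%:R : K)^-1 by rewrite invr_gt0 ltr0Sn.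
have q_ i : exists q : rat, `|x 0 i - ratr q| < k.+1%:R^-1.
  have : x 0 i - k.+1%:R^-1 < x 0 i + k.+1%:R^-1 by rewrite ltrBlDr -addrA ltrDl addr_gt0.
  move=> /rat_in_itvoo[q]; rewrite in_itv/= => qx; exists q.
  by move: qx => /andP[q1 q2]; rewrite ltr_distlC q1.
have [q qx] := choice q_.
exists (\row_i q i, k); split => [i /=|y yb]; first by rewrite mxE.
apply: eU; split => // i j; rewrite (ord1 i).
have := yb j; have := qx j; rewrite /= mxE => h1 h2.
rewrite /ball/=; rewrite -[X in `|X|](subrKA (ratr (q j))).
apply: (le_lt_trans (ler_normD _ _)); rewrite (distrC (ratr _)).
by rewrite (splitr e) ltrD// (lt_trans _ kE).
Qed.

Lemma coord_measurable (K : realType) (n : nat) (i : 'I_n) :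
  measurable_fun [set: borel_rV K n] (fun x : borel_rV K n => x 0 i).
Proof.
apply: (measurability _ (RGenOpens.measurableE K)).
move=> _ [_ [a [b ->] <-]]; rewrite setTI.
apply: sub_sigma_algebra.
apply: open_comp; first by move=> x _; exact: coord_continuous.
exact: interval_open.
Qed.

Lemma rat_ball_measurable d (T : measurableType d) (K : realType) (n : nat)
    (F : T -> 'rV[K]_n) p :
  (forall i, measurable_fun [set: T] (fun t => F t 0 i)) ->
  measurable (F @^-1` @rat_ball K n p).
Proof.
move=> mF; rewrite (_ : _ @^-1` _ = \bigcap_(i in [set: 'I_n])
   ((fun t => F t 0 i) @^-1` ball (ratr (p.1 0 i) : K) (p.2.+1%:R^-1 : K))).
  apply: fin_bigcap_measurable => // i _; rewrite -[X in measurable X]setTI.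
  by apply: mF => //; exact: measurable_ball.
apply/seteqP; split => t /= h i.
  by move=> _; rewrite /= /ball/= distrC; exact: h.
by have := h i I; rewrite /ball/= distrC.
Qed.

(** The Borel sets are generated by open sets rather than by boxes. An open set is a countable union
    of rational cubes, and the preimage of a cube is a finite intersection of coordinate
    preimages. *)
Lemma measurable_rV d (T : measurableType d) (K : realType) (n : nat)
    (F : T -> borel_rV K n) :
  (forall i, measurable_fun [set: T] (fun t => F t 0 i)) ->
  measurable_fun [set: T] F.
Proof.
move=> mF; apply: (@measurability _ _ T (borel_rV K n) _ F open erefl).
move=> _ [U oU <-]; rewrite setTI.
rewrite (_ : _ @^-1` _ = \bigcup_p
    ((if `[<@rat_ball K n p `<=` U>] then F @^-1` @rat_ball K n p else set0) : set T)).
  apply: countable_bigcupT_measurable => [|p]; first exact: countableP.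
  by case: ifPn => _ //; exact: rat_ball_measurable.
apply/seteqP; split => t /=.
  move=> Ut; have [p [pt pU]] := rat_ball_basis oU Ut.
  by exists p => //; rewrite ifT//; apply/asboolP.
by move=> [p _]; case: ifPn => // /asboolP h; exact: h.
Qed.

Lemma closed_msupport (K : realType) (n : nat) (mu : borel_measure K n) :
  closed (msupport mu).
Proof.
rewrite -[msupport mu]setCK; apply: open_closedC.
rewrite openE => x /existsNP[U /not_implyP[oU /not_implyP[Ux Upos]]].
apply: (@filterS _ _ _ U); last exact: open_nbhs_nbhs.
by move=> y Uy h; apply: Upos; exact: h.
Qed.

(** Lindelof argument: each point outside the support has a null open neighbourhood, hence lies in a
    null rational cube, and there are countably many of these. *)
Lemma msupportC_null (K : realType) (n : nat) (mu : borel_measure K n) :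
  mu (~` msupport mu) = 0%E.
Proof.
have mball p : measurable (@rat_ball K n p : set (borel_rV K n)).
  exact: (@rat_ball_measurable _ (borel_rV K n) _ _ id p (@coord_measurable K n)).
have mopen (U : set 'rV[K]_n) : open U -> measurable (U : set (borel_rV K n)).
  exact: sub_sigma_algebra.
(* An enumeration of the null cubes, padded with the empty set. *)
pose N k := if unpickle k is Some p then
  (if mu (@rat_ball K n p) == 0%E then @rat_ball K n p else set0) else set0.
have N0 k : mu.-negligible (N k : set (borel_rV K n)).
  rewrite /N; case: unpickle => [p|]; last exact: negligible_set0.
  case: ifPn => [/eqP p0|_]; last exact: negligible_set0.
  by apply/negligibleP.
have [A [mA A0 cA]] : mu.-negligible (~` msupport mu : set (borel_rV K n)).
  apply: negligibleS (negligible_bigcup N0) => x.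
  move=> /existsNP[U /not_implyP[oU /not_implyP[Ux Upos]]].
  have [p [px pU]] := rat_ball_basis oU Ux; exists (pickle p) => //.
  rewrite /N pickleK ifT//; apply/eqP/le_anti/andP; split => //.
  rewrite (le_trans (le_measure mu _ _ pU)) ?inE//; first exact: mopen.
  by rewrite leNgt; exact/negP.
apply/eqP; rewrite -measure_le0 -[leRHS]A0 le_measure ?inE//.
by apply: mopen; rewrite openC; exact: closed_msupport.
Qed.

(** The complement of [C] is open and null, so it contains no point of the support. This replaces
    the computation of a support by a null-set check. *)
Lemma carried_by_compact (K : realType) (n : nat) (C A : set 'rV[K]_n)
    (mu : borel_measure K n) :
  mu [set: 'rV[K]_n] <> 0%E -> mu (~` C) = 0%E -> compact C -> C `<=` A ->
  carried_by A mu.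
Proof.
move=> mu0 muC cC CA.
have sC : msupport mu `<=` C.
  move=> x xs; apply: contrapT => nCx.
  have clC : closed C by apply: compact_closed cC; exact: norm_hausdorff.
  by have := xs (~` C) (closed_openC clC) nCx; rewrite muC ltxx.
split => //; last exact: subset_trans sC CA.
by apply: subclosed_compact sC => //; exact: closed_msupport.
Qed.

(** * Integrals of bounded measurable functions *)

(** A class stable under the operations needed below and integrable for every finite measure, so
    that real-valued integrals can be manipulated with a single side condition. *)
Definition bounded_measurable d (T : measurableType d) (K : realType)
    (f : T -> K) :=
  measurable_fun [set: T] f /\ exists M, forall x, `|f x| <= M.

Section bounded_measurable_theory.
Context d (T : measurableType d) (K : realType).
Implicit Types (f g : T -> K) (m : {finite_measure set T -> \bar K}).

Lemma bounded_measurable_cst (c : K) :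
  bounded_measurable (fun _ : T => c).
Proof. by split; [exact: measurable_cst|exists `|c|]. Qed.

Lemma bounded_measurable_add f g : bounded_measurable f ->
  bounded_measurable g -> bounded_measurable (fun x => f x + g x).
Proof.
move=> [mf [M fM]] [mg [N gN]]; split; first exact: measurable_funD.
by exists (M + N) => x; rewrite (le_trans (ler_normD _ _))// lerD.
Qed.

Lemma bounded_measurable_mul f g : bounded_measurable f ->
  bounded_measurable g -> bounded_measurable (fun x => f x * g x).
Proof.
move=> [mf [M fM]] [mg [N gN]]; split; first exact: measurable_funM.
by exists (M * N) => x; rewrite normrM ler_pM.
Qed.

Lemma bounded_measurable_cos f : measurable_fun [set: T] f ->
  bounded_measurable (fun x => cos (f x)).
Proof.
move=> mf; split; last by exists 1 => x; rewrite ler_norml cos_geN1 cos_le1.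
by apply: measurableT_comp => //; apply: continuous_measurable_fun; exact: continuous_cos.
Qed.

Lemma bounded_measurable_sin f : measurable_fun [set: T] f ->
  bounded_measurable (fun x => sin (f x)).
Proof.
move=> mf; split; last by exists 1 => x; rewrite ler_norml sin_geN1 sin_le1.
by apply: measurableT_comp => //; apply: continuous_measurable_fun; exact: continuous_sin.
Qed.

Lemma bounded_measurable_exp f n : bounded_measurable f ->
  bounded_measurable (fun x => f x ^+ n).
Proof.
move=> bf; elim: n => [|n IH]; first exact: bounded_measurable_cst.
by under eq_fun do rewrite exprS; exact: bounded_measurable_mul.
Qed.

Lemma bounded_measurable_norm f : bounded_measurable f ->
  bounded_measurable (fun x => `|f x|).
Proof.
move=> [mf [M fM]]; split; first exact: measurableT_comp.
by exists M => x; rewrite normr_id.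
Qed.

Lemma bounded_measurable_indic (A : set T) : measurable A ->
  bounded_measurable (\1_A : T -> K).
Proof.
move=> mA; split; first exact: measurable_indic.
by exists 1 => x; rewrite indicE; case: (_ \in _); rewrite ?normr1 ?normr0.
Qed.

Lemma bounded_measurable_comp d' (T' : measurableType d') f (h : T' -> T) :
  measurable_fun [set: T'] h -> bounded_measurable f ->
  bounded_measurable (fun x => f (h x)).
Proof.
move=> mh [mf [M fM]]; split; last by exists M.
exact: measurableT_comp mf mh.
Qed.

Lemma bounded_measurable_integrable m f :
  bounded_measurable f -> m.-integrable setT (EFin \o f).
Proof.
move=> [mf [M fM]]; apply: measurable_bounded_integrable => //.
  by rewrite -ge0_fin_numE// fin_num_measure.
exists M; split; first exact: num_real.
by move=> N MN x _; exact: le_trans (fM x) (ltW MN).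
Qed.

Lemma EFin_Rintegral m f : bounded_measurable f ->
  (\int[m]_x f x)%:E = (\int[m]_x (f x)%:E)%E.
Proof.
move=> /(bounded_measurable_integrable m) fi; rewrite /Rintegral fineK//.
exact: integrable_fin_num.
Qed.

Lemma Rintegral_add m f g : bounded_measurable f -> bounded_measurable g ->
  \int[m]_x (f x + g x) = \int[m]_x f x + \int[m]_x g x.
Proof. by move=> bf bg; rewrite RintegralD//; exact: bounded_measurable_integrable. Qed.

Lemma Rintegral_scale m (c : K) f : bounded_measurable f ->
  \int[m]_x (c * f x) = c * \int[m]_x f x.
Proof. by move=> bf; rewrite RintegralZl//; exact: bounded_measurable_integrable. Qed.

Lemma Rintegral_constant m (c : K) : \int[m]_x c = c * fine (m setT).
Proof. by rewrite Rintegral_cst. Qed.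

Lemma Rintegral_indicator m (A : set T) : measurable A ->
  \int[m]_x \1_A x = fine (m A) :> K.
Proof. by move=> mA; rewrite /Rintegral integral_indic// setIT. Qed.

Lemma Rintegral_indicator_eq0 m (A : set T) : measurable A ->
  \int[m]_x (\1_A x : K) = 0 -> m A = 0%E.
Proof.
move=> mA A0; rewrite -[LHS]fineK ?fin_num_measure//.
by rewrite -Rintegral_indicator// A0.
Qed.

Lemma ler_Rintegral m f g : bounded_measurable f -> bounded_measurable g ->
  (forall x, f x <= g x) -> \int[m]_x f x <= \int[m]_x g x.
Proof.
by move=> bf bg fg; apply: le_Rintegral => //; exact: bounded_measurable_integrable.
Qed.

Lemma normr_Rintegral_le m f (M : K) : measurable_fun setT f ->
  (forall x, `|f x| <= M) -> `|\int[m]_x f x| <= M * fine (m setT).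
Proof.
move=> mf fM; have bf : bounded_measurable f by split => //; exists M.
rewrite (le_trans (le_normr_Rintegral _ _))//.
  exact: bounded_measurable_integrable.
rewrite -Rintegral_constant; apply: ler_Rintegral => //.
  exact: bounded_measurable_norm.
exact: bounded_measurable_cst.
Qed.

Lemma Rintegral_null m f g (A : set T) : bounded_measurable f ->
  bounded_measurable g -> measurable A -> m A = 0%E ->
  (forall x, ~ A x -> f x = g x) -> \int[m]_x f x = \int[m]_x g x.
Proof.
move=> bf bg mA A0 fg; rewrite /Rintegral; congr fine.
apply: ae_eq_integral => //.
- by apply/measurable_EFinP; case: bf.
- by apply/measurable_EFinP; case: bg.
- exists A; split => // x /= /not_implyP[_ nfg]; apply: contrapT => /fg h.
  by apply: nfg; rewrite h.
Qed.

End bounded_measurable_theory.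

(** * Weighted images, products and mixtures of finite measures *)

Section weighted_pushforward.
Context d d' (T : measurableType d) (Y : measurableType d') (K : realType).
Variables (m : {finite_measure set T -> \bar K}) (w : T -> K) (F : T -> Y).
Hypotheses (w0 : forall x, 0 <= w x) (bw : bounded_measurable w).
Hypothesis mF : measurable_fun [set: T] F.

Let cstk (_ : unit) : {measure set T -> \bar K} := m.

Let cstk_measurable U : measurable U -> measurable_fun setT (cstk ^~ U).
Proof. by []. Qed.

HB.instance Definition _ := isKernel.Build _ _ _ _ _ cstk cstk_measurable.

Let cstk_uub : measure_fam_uub cstk.
Proof.
exists (fine (m setT) + 1) => t; rewrite EFinD fineK ?fin_num_measure//.
by rewrite lteDl ?fin_num_measure// lte01.
Qed.

HB.instance Definition _ := Kernel_isFinite.Build _ _ _ _ _ cstk cstk_uub.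

Let wdirac (x : unit * T) : {measure set Y -> \bar K} :=
  mscale (NngNum (w0 x.2)) (dirac (F x.2)).

Let wdiracE x U : wdirac x U = (w x.2 * \1_U (F x.2))%:E.
Proof. by rewrite /wdirac /= /mscale /= diracE indicE. Qed.

Let wdirac_measurable U : measurable U -> measurable_fun setT (wdirac ^~ U).
Proof.
move=> mU; under eq_fun do rewrite wdiracE.
apply/measurable_EFinP/measurable_funM.
  by apply: measurableT_comp => //; case: bw.
apply: (measurableT_comp (measurable_indic mU)).
exact: measurableT_comp mF measurable_snd.
Qed.

HB.instance Definition _ := isKernel.Build _ _ _ _ _ wdirac wdirac_measurable.

Let wdirac_uub : measure_fam_uub wdirac.
Proof.
have [_ [M wM]] := bw; exists (M + 1) => x.
rewrite wdiracE indicT mulr1 lte_fin ltr_pwDr//.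
exact: le_trans (ler_norm _) (wM _).
Qed.

HB.instance Definition _ := Kernel_isFinite.Build _ _ _ _ _ wdirac wdirac_uub.

(** The measure [nu] is the composition of the constant kernel [m] with the kernel sending [x] to
    the point mass of weight [w x] at [F x]. The integral formula for nonnegative [f] is then that
    of kernel composition. *)
Lemma weighted_pushforward_ex : exists nu : {finite_measure set Y -> \bar K},
  forall f, bounded_measurable f ->
    \int[nu]_y f y = \int[m]_x (w x * f (F x)).
Proof.
pose nu0 := mkcomp cstk wdirac tt.
have [mw [M wM]] := bw.
have nu0E f : bounded_measurable f -> (forall x, 0 <= f x) ->
    (\int[nu0]_y (f y)%:E = \int[m]_x (w x * f (F x))%:E)%E.
  move=> [mf _] f0; rewrite /nu0 integral_kcomp//; last exact/measurable_EFinP.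
  apply: eq_integral => x _; rewrite ge0_integral_mscale//=.
  - by rewrite integral_dirac//; [rewrite diracT mul1e|exact/measurable_EFinP].
  - exact/measurable_EFinP.
  - by move=> y _; rewrite lee_fin.
have nu0T : (nu0 setT < +oo)%E.
  rewrite -[nu0 setT]mul1e -integral_cst// nu0E//; last exact: bounded_measurable_cst.
  under eq_integral do rewrite mulr1.
  by rewrite -EFin_Rintegral// ltry.
have nu0fin : fin_num_fun nu0 by exact: lty_fin_num_fun.
pose H := Measure_isFinite.Build _ _ _ nu0 nu0fin.
pose nu : {finite_measure set Y -> \bar K} :=
  HB.pack_for (FiniteMeasure.type Y K) (Measure.sort nu0) H.
exists nu => f [mf [N fN]].
have bf : bounded_measurable f by split => //; exists N.
have bwF : bounded_measurable (fun x => w x * f (F x)).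
  by apply: bounded_measurable_mul => //; exact: bounded_measurable_comp.
have bfN : bounded_measurable (fun x => f x + N).
  by apply: bounded_measurable_add => //; exact: bounded_measurable_cst.
have fN0 x : 0 <= f x + N by have := fN x; rewrite ler_norml; lra.
have key (g : Y -> K) : bounded_measurable g -> (forall x, 0 <= g x) ->
   \int[nu]_y g y = \int[m]_x (w x * g (F x)).
  by move=> bg g0; rewrite /Rintegral nu0E.
(* Adding the bound [N] of [|f|] reduces signed functions to nonnegative ones. *)
apply: (addIr (\int[nu]_y N)).
rewrite -Rintegral_add//; last exact: bounded_measurable_cst.
rewrite !key//; last 2 first.
- exact: bounded_measurable_cst.
- by move=> x; exact: le_trans (fN x).
rewrite -Rintegral_add//; last first.
  by apply: bounded_measurable_mul => //; exact: bounded_measurable_cst.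
by under eq_Rintegral do rewrite mulrDr.
Qed.

End weighted_pushforward.

Section product.
Context d1 d2 (T1 : measurableType d1) (T2 : measurableType d2) (K : realType).
Variables (m1 : {finite_measure set T1 -> \bar K})
  (m2 : {finite_measure set T2 -> \bar K}).

(** Repackages the product as a finite measure, to which the calculus of bounded measurable
    functions applies. *)
Lemma product_finite_ex : exists m : {finite_measure set (T1 * T2)%type -> \bar K},
  (forall A, m A = (m1 \x m2)%E A).
Proof.
have fin : fin_num_fun (m1 \x m2)%E.
  apply: lty_fin_num_fun; have := product_measure1E m1 m2 measurableT measurableT.
  rewrite setXTT => mT; apply: (eq_ind_r (fun z => (z < +oo)%E) _ mT).
  by rewrite lte_mul_pinfty// -?ge0_fin_numE// fin_num_measure.
pose H := Measure_isFinite.Build _ _ _ (m1 \x m2)%E fin.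
pose nu : {finite_measure set (T1 * T2)%type -> \bar K} :=
  HB.pack_for (FiniteMeasure.type (T1 * T2)%type K) (Measure.sort (m1 \x m2)%E) H.
by exists nu.
Qed.

Lemma bounded_measurable_Rintegral (f : (T1 * T2)%type -> K) :
  bounded_measurable f -> bounded_measurable (fun x => \int[m2]_y f (x, y)).
Proof.
move=> bf; have [m mE] := product_finite_ex.
have [mf [M fM]] := bf.
have imf : (m1 \x m2)%E.-integrable setT (EFin \o f).
  have := bounded_measurable_integrable m bf => /integrableP[mf' fi].
  apply/integrableP; split => //; apply: le_lt_trans fi.
  rewrite (eq_measure_integral m)// => A mA _; exact/esym/mE.
split; last first.
  exists (M * fine (m2 setT)) => x; apply: normr_Rintegral_le => //.
  exact: measurableT_comp mf (pair1_measurable _).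
apply/measurable_EFinP.
rewrite (_ : _ \o _ = fubini_F m2 (EFin \o f)); first exact: measurable_fubini_F imf.
apply/funext => x; rewrite /= EFin_Rintegral//.
by split; [exact: measurableT_comp mf (pair1_measurable _)|exists M].
Qed.

Lemma Rintegral_product_ex : exists m : {finite_measure set (T1 * T2)%type -> \bar K},
  forall f : (T1 * T2)%type -> K, bounded_measurable f ->
  \int[m]_z f z = \int[m1]_x \int[m2]_y f (x, y) /\
  \int[m]_z f z = \int[m2]_y \int[m1]_x f (x, y).
Proof.
have [m mE] := product_finite_ex.
exists m => f bf; have [mf [M fM]] := bf.
have imf : (m1 \x m2)%E.-integrable setT (EFin \o f).
  have := bounded_measurable_integrable m bf => /integrableP[mf' fi].
  apply/integrableP; split => //; apply: le_lt_trans fi.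
  rewrite (eq_measure_integral m)// => A mA _; exact/esym/mE.
have mE' : (\int[m]_z (f z)%:E = \int[(m1 \x m2)%E]_z (f z)%:E)%E.
  by apply: eq_measure_integral => A mA _; exact: mE.
split; rewrite /Rintegral mE'.
  rewrite -integral12_prod_meas1//; congr fine; apply: eq_integral => x _ /=.
  rewrite EFin_Rintegral//.
  by split; [exact: measurableT_comp mf (pair1_measurable _)|exists M].
rewrite -integral21_prod_meas1//; congr fine; apply: eq_integral => x _ /=.
rewrite EFin_Rintegral//.
by split; [exact: measurableT_comp mf (pair2_measurable _)|exists M].
Qed.

End product.

Lemma Rintegral_swap d1 d2 (T1 : measurableType d1) (T2 : measurableType d2)
    (K : realType) (m1 : {finite_measure set T1 -> \bar K})
    (m2 : {finite_measure set T2 -> \bar K}) (f : T1 -> T2 -> K) :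
  bounded_measurable (fun z => f z.1 z.2) ->
  \int[m1]_x \int[m2]_y f x y = \int[m2]_y \int[m1]_x f x y.
Proof.
by move=> bf; have [m mE] := Rintegral_product_ex m1 m2; have [<- <-] := mE _ bf.
Qed.

(** The image of [w(t) m(dt) sigma(dy)] under [(t, y) |-> F t y]. Two instances are used: the
    suspension of a sphere measure and the radial lift of a measure on [R]. *)
Lemma mixture_ex d (T : measurableType d) (K : realType) (n p : nat)
    (m : {finite_measure set T -> \bar K}) (sigma : borel_measure K n)
    (w : T -> K) (F : T -> 'rV[K]_n -> 'rV[K]_p) :
  (forall t, 0 <= w t) -> bounded_measurable w ->
  (forall i, measurable_fun setT (fun z : T * borel_rV K n => F z.1 z.2 0 i)) ->
  exists nu : borel_measure K p,
    forall f : borel_rV K p -> K, bounded_measurable f ->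
      bounded_measurable (fun t => \int[sigma]_y f (F t y)) /\
      \int[nu]_x f x = \int[m]_t (w t * \int[sigma]_y f (F t y)).
Proof.
move=> w0 bw mF; have [m2 m2E] := Rintegral_product_ex m sigma.
have mF' : measurable_fun setT (fun z : T * borel_rV K n => F z.1 z.2 : borel_rV K p).
  exact: measurable_rV.
have bw' : bounded_measurable (fun z : T * borel_rV K n => w z.1).
  exact: (bounded_measurable_comp measurable_fst).
have [nu nuE] := weighted_pushforward_ex m2 (w := fun z => w z.1) (fun z => w0 z.1) bw' mF'.
exists nu => f bf.
have bfF := bounded_measurable_comp mF' bf.
split; first exact: bounded_measurable_Rintegral bfF.
rewrite nuE//; have [-> _] := m2E _ (bounded_measurable_mul bw' bfF).
apply: eq_Rintegral => t _ /=; rewrite Rintegral_scale//.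
exact: (bounded_measurable_comp (pair1_measurable t) bfF).
Qed.

(** Dominated differentiation under the integral; the dominating function is the constant [|M|],
    integrable because [m] is finite. *)
Lemma is_derive_Rintegral d (T : measurableType d) (K : realType)
    (m : {finite_measure set T -> \bar K}) (f f' : K -> T -> K) (M : K) :
  (forall x, bounded_measurable (f x)) ->
  (forall (x : K) t, is_derive x 1 (f ^~ t) (f' x t)) ->
  (forall x t, `|f' x t| <= M) ->
  forall x : K, is_derive x 1 (fun x => \int[m]_t f x t) (\int[m]_t f' x t).
Proof.
move=> bf df f'M x.
have f'E y t : partial1of2 f y t = f' y t.
  by have := df y t => ?; rewrite partial1of2E derive_val.
have Ix : `]x - 1, x + 1[%classic x by rewrite /= in_itv/= ltrBlDr ltrDl ltr01.
have iG := bounded_measurable_integrable m (bounded_measurable_cst _ `|M|).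
have H1 := @derivable_under_integral K _ T m f setT measurableT x (x-1) (x+1) Ix
  (fun y _ => bounded_measurable_integrable m (bf y))
  (fun y t _ _ => @ex_derive _ _ _ _ _ _ _ (df y t)) (fun=> `|M|) (fun=> normr_ge0 _) iG.
have H2 := @differentiation_under_integral K _ T m f setT measurableT x (x-1) (x+1) Ix
  (fun y _ => bounded_measurable_integrable m (bf y))
  (fun y t _ _ => @ex_derive _ _ _ _ _ _ _ (df y t)) (fun=> `|M|) (fun=> normr_ge0 _) iG.
have H3 y t : `]x - 1, x + 1[%classic y -> [set: T] t -> `|partial1of2 f y t| <= `|M|.
  by move=> _ _; rewrite f'E (le_trans (f'M _ _))// ler_norm.
apply: DeriveDef; first exact: H1.
rewrite -derive1E H2//; apply: eq_Rintegral => t _; exact: f'E.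
Qed.

(** * Rotation-invariant measures on spheres *)

Lemma is_derive_continuous (K : realType) (f f' : K -> K) :
  (forall x : K, is_derive x 1 f (f' x)) -> continuous f.
Proof. by move=> df x; apply/differentiable_continuous/derivable1_diffP; have [] := df x. Qed.

(** Normalised Lebesgue measure on [[0, pi]]; the factor [1 / pi] only rescales the sphere measures
    built from it. *)
Definition angle_measure (K : realType) :
  {finite_measure set (measurableTypeR K) -> \bar K} := uniform_prob (@pi_gt0 K).

Section angle_measure_theory.
Variable K : realType.
Notation U := (angle_measure K).

Lemma angle_measureT : fine (U setT) = 1.
Proof.
rewrite (_ : U setT = 1%E)//.
exact: (@probability_setT _ _ _ (uniform_prob (@pi_gt0 K))).
Qed.

Lemma angle_measureC : U (~` `[0, pi]) = 0%E.
Proof.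
rewrite /angle_measure /= /uniform_prob integral_uniform_pdf setICl.
by rewrite integral_set0.
Qed.

Lemma eq_angle_Rintegral (f g : measurableTypeR K -> K) :
  bounded_measurable f -> bounded_measurable g ->
  (forall x, 0 <= x <= pi -> f x = g x) -> \int[U]_x f x = \int[U]_x g x.
Proof.
move=> bf bg fg; apply: (Rintegral_null bf bg _ angle_measureC).
  by apply: measurableC; exact: measurable_itv.
by move=> x /contrapT; rewrite /= in_itv/=; exact: fg.
Qed.

Lemma angle_FTC (F f : K -> K) (M : K) : (forall x : K, is_derive x 1 F (f x)) ->
  continuous f -> (forall x, `|f x| <= M) ->
  \int[U]_x f x = pi^-1 * (F pi - F 0).
Proof.
move=> dF cf fM.
have bf : bounded_measurable (f : measurableTypeR K -> K).
  by split; [exact: continuous_measurable_fun|exists M].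
(* Shifting by [M] makes the integrand nonnegative, as the formula for the uniform law requires; the
   primitive is shifted by [M x] accordingly. *)
apply: (addIr (\int[U]_x M)).
rewrite -Rintegral_add//; last exact: bounded_measurable_cst.
rewrite Rintegral_constant angle_measureT mulr1.
pose G x := F x + M * x.
have dG (x : K) : is_derive x 1 G (f x + M).
  by have := dF x => ?; derive_by ring.
have cg : continuous (fun x => f x + M).
  by move=> x; apply: cvgD; [exact: cf|exact: cvg_cst].
have cG := is_derive_continuous dG.
rewrite /Rintegral integral_uniform//; first last.
- by move=> x; rewrite lee_fin; have := fM x; rewrite ler_norml; lra.
- by apply/measurable_EFinP; exact: continuous_measurable_fun.
rewrite (continuous_FTC2 (F := G))//; first last.
- by move=> x _; have := dG x => ?; rewrite derive1E derive_val.
- split=> [x _|//|//]; first by have [] := dG x.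
  + exact/cvg_at_right_filter/cG.
  + exact/cvg_at_left_filter/cG.
- exact: continuous_subspaceT.
- exact: pi_gt0.
rewrite /G /= subr0; have : pi != 0 :> K by rewrite gt_eqF// pi_gt0.
by move: (F pi) (F 0) (pi : K) => a b p p0; field.
Qed.

End angle_measure_theory.

(* [J1] is the derivative of [J], and [H x] stands for [J1 x / x], so that the
   Bessel equation [J'' + (n / x) J' + J = 0] makes sense at [x = 0] as well. *)
Record radial_profile (K : realType) (n : nat) (J J1 H : K -> K) : Prop := {
  profile_deriv : forall x : K, is_derive x 1 J (J1 x);
  profile_deriv1 : forall x : K, is_derive x 1 J1 (- J x - n%:R * H x);
  profile_div : forall x, J1 x = x * H x;
  profile_bounded : exists M, forall x, `|J x| <= M /\ `|J1 x| <= M;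
  profile_gt0 : 0 < J 0 }.

Lemma cos_norm1 (K : realType) (x : K) : `|cos x| <= 1.
Proof. by rewrite ler_norml cos_geN1 cos_le1. Qed.

Lemma sin_norm1 (K : realType) (x : K) : `|sin x| <= 1.
Proof. by rewrite ler_norml sin_geN1 sin_le1. Qed.

Lemma sin_exp_norm1 (K : realType) (x : K) n : `|sin x ^+ n| <= 1.
Proof. by rewrite normrX exprn_ile1// sin_norm1. Qed.

Lemma mul_norm_le1 (K : realType) (x y : K) : `|x| <= 1 -> `|y| <= 1 -> `|x * y| <= 1.
Proof. by move=> x1 y1; rewrite normrM mulr_ile1. Qed.

Section angle_integrals.
Variable K : realType.
Notation U := (angle_measure K).
Implicit Types (a b c x rho : K).

Lemma measurable_cos_angle : measurable_fun [set: measurableTypeR K] cos.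
Proof. by apply: continuous_measurable_fun; exact: continuous_cos. Qed.

Lemma measurable_sin_angle : measurable_fun [set: measurableTypeR K] sin.
Proof. by apply: continuous_measurable_fun; exact: continuous_sin. Qed.

Lemma bounded_measurable_sin_exp n :
  bounded_measurable (fun t : measurableTypeR K => sin t ^+ n).
Proof. by apply: bounded_measurable_exp; exact: bounded_measurable_sin. Qed.

Lemma bounded_measurable_cos_lin a c :
  bounded_measurable (fun t : measurableTypeR K => cos (a * cos t + c)).
Proof.
apply: bounded_measurable_cos; apply: measurable_funD => //.
by apply: measurable_funM => //; exact: measurable_cos_angle.
Qed.

(** Wallis recursion: integrating the derivative of [- cos t (sin t)^(m+1)] gives
    [(m+2) I_(m+2) = (m+1) I_m], and [I_0], [I_1] are positive. *)
Lemma angle_sin_exp_gt0 n : 0 < \int[U]_t (sin t ^+ n).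
Proof.
have rec m : m.+2%:R * \int[U]_t (sin t ^+ m.+2) = m.+1%:R * \int[U]_t (sin t ^+ m).
  have bm k (c : K) : bounded_measurable (fun t : measurableTypeR K => c * sin t ^+ k).
    by apply: bounded_measurable_mul (bounded_measurable_sin_exp _); exact: bounded_measurable_cst.
  have := @angle_FTC K (fun t => - cos t * sin t ^+ m.+1)
    (fun t => m.+2%:R * sin t ^+ m.+2 + (- m.+1%:R) * sin t ^+ m) (m.+2%:R + m.+1%:R).
  rewrite sinpi sin0 !expr0n !mulr0 subrr mulr0 => H.
  apply/subr0_eq; rewrite -mulNr -!Rintegral_scale; try exact: bounded_measurable_sin_exp.
  rewrite -Rintegral_add//; apply: H => t.
  - derive_by idtac.
    have -> : sin t ^+ m.+2 = (1 - cos t ^+ 2) * sin t ^+ m by rewrite -sin2cos2 -exprD.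
    rewrite [sin t ^+ m.+1]exprS -[m.+2%:R]natr1.
    have : sin t * sin t = 1 - cos t ^+ 2 by rewrite -sin2cos2.
    move: (sin t) => s h.
    transitivity (s * s * s ^+ m - m.+1%:R * cos t ^+ 2 * s ^+ m); first by ring.
    by rewrite h; ring.
  - by apply: is_derive_continuous => s; derivs.
  - rewrite (le_trans (ler_normD _ _))// [X in X + _]normrM [X in _ + X]normrM normrN !normr_nat.
    by apply: lerD; apply: ler_piMr => //; exact: sin_exp_norm1.
elim/ltn_ind: n => -[|[|n]] IH.
- under eq_Rintegral do rewrite expr0.
  by rewrite Rintegral_constant angle_measureT mulr1.
- under eq_Rintegral do rewrite expr1.
  have -> : \int[U]_t (sin t) = pi^-1 * ((- cos pi) - (- cos 0)).
    apply: (@angle_FTC K (fun t => - cos t) sin 1) => [t||t].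
    + by derive_by ring.
    + exact: continuous_sin.
    + exact: sin_norm1.
  rewrite cospi cos0 mulr_gt0// ?invr_gt0 ?pi_gt0//; lra.
- have : 0 < n.+1%:R * \int[U]_t (sin t ^+ n) by rewrite mulr_gt0// IH.
  by rewrite -rec pmulr_rgt0.
Qed.
End angle_integrals.

(** * Suspension: passing from a sphere to the sphere of the next dimension *)

Section suspension.
Variables (K : realType) (n : nat) (J J1 H : K -> K).
Hypothesis prof : radial_profile n J J1 H.
Notation U := (angle_measure K).
Implicit Types (a b c x rho phi : K).

(** The transform of the suspended measure at a frequency of length [x] along the polar axis, where
    the integral over the lower sphere contributes only its total mass [J 0]. *)
Definition suspended_profile x : K :=
  J 0 * \int[U]_t (sin t ^+ n * cos (x * cos t)).
Definition suspended_profile1 x : K :=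
  J 0 * \int[U]_t (sin t ^+ n * (- sin (x * cos t) * cos t)).
(** The quotient of [suspended_profile1 x] by [x], in the form obtained from integration by parts,
    which makes sense at 0. *)
Definition suspended_profile_div x : K :=
  - (J 0 / n.+1%:R) * \int[U]_t (sin t ^+ n.+2 * cos (x * cos t)).

Let bm_cos k x :
  bounded_measurable (fun t : measurableTypeR K => sin t ^+ k * cos (x * cos t)).
Proof.
apply: bounded_measurable_mul; first exact: bounded_measurable_sin_exp.
by have := bounded_measurable_cos_lin x 0; under eq_fun do rewrite addr0.
Qed.

Let bm_sin k x : bounded_measurable
  (fun t : measurableTypeR K => sin t ^+ k * (- sin (x * cos t) * cos t)).
Proof.
apply: bounded_measurable_mul; first exact: bounded_measurable_sin_exp.
apply: bounded_measurable_mul; last exact: bounded_measurable_cos.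
under eq_fun do rewrite -mulN1r.
apply: bounded_measurable_mul; first exact: bounded_measurable_cst.
apply: bounded_measurable_sin; apply: measurable_funM => //.
exact: measurable_cos_angle.
Qed.

Let n0 : 1 + n%:R != 0 :> K. Proof. by rewrite addrC natr1 pnatr_eq0. Qed.

(** Both derivatives are taken under the integral. Writing [(cos t)^2 = 1 - (sin t)^2] in the second
    one produces the Bessel equation, with dimension raised by one. *)
Lemma suspended_profileP :
  radial_profile n.+1 suspended_profile suspended_profile1 suspended_profile_div.
Proof.
have c0 := profile_gt0 prof.
have nrm (u v : K) k t : `|u| <= 1 -> `|v| <= 1 -> `|sin t ^+ k * (u * v)| <= 1.
  by move=> u1 v1; rewrite mul_norm_le1 ?sin_exp_norm1// mul_norm_le1.
have N1 (u : K) : `|u| <= 1 -> `|- u| <= 1 by rewrite normrN.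
split.
- move=> x; apply: deriv_eq; first apply: deriv_scale.
    apply: (is_derive_Rintegral U (f := fun x t => sin t ^+ n * cos (x * cos t))
      (f' := fun x t => sin t ^+ n * (- sin (x * cos t) * cos t)) (M := 1)).
    + by move=> y; exact: bm_cos.
    + by move=> y t; derive_by ring.
    + by move=> y t; apply: nrm; rewrite ?N1 ?sin_norm1 ?cos_norm1.
  by [].
- move=> x; apply: deriv_eq; first apply: deriv_scale.
    apply: (is_derive_Rintegral U (f := fun x t => sin t ^+ n * (- sin (x * cos t) * cos t))
      (f' := fun x t => sin t ^+ n * (- (cos (x * cos t) * cos t) * cos t)) (M := 1)).
    + by move=> y; exact: bm_sin.
    + by move=> y t; derive_by ring.
    + move=> y t; apply: nrm; rewrite ?cos_norm1//.
      by rewrite N1// mul_norm_le1 ?cos_norm1.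
  rewrite /suspended_profile /suspended_profile_div.
  transitivity (J 0 * (\int[U]_t (sin t ^+ n.+2 * cos (x * cos t)) +
     - 1 * \int[U]_t (sin t ^+ n * cos (x * cos t)))).
    congr (_ * _); rewrite -Rintegral_scale; last exact: bm_cos.
    rewrite -Rintegral_add; last 2 first.
    + exact: bm_cos.
    + by apply: bounded_measurable_mul (bm_cos _ _); exact: bounded_measurable_cst.
    apply: eq_Rintegral => t _.
    have -> : sin t ^+ n.+2 = (1 - cos t ^+ 2) * sin t ^+ n by rewrite -sin2cos2 -exprD.
    ring.
  move: (\int[_]_t _) (\int[_]_t _) => u v; field; exact: n0.
- move=> x.
  (* A total derivative: its primitive carries a factor [(sin t)^(n+1)] and vanishes at 0 and
     [pi]. *)
  pose f t := sin t ^+ n * (- sin (x * cos t) * cos t) +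
    x / n.+1%:R * (sin t ^+ n.+2 * cos (x * cos t)).
  have H0 : \int[U]_t f t = 0.
    have := @angle_FTC K (fun t => - (n.+1%:R^-1) * sin t ^+ n.+1 * sin (x * cos t)) f
      (1 + `|x / n.+1%:R|).
    rewrite sinpi sin0 !expr0n !mulr0 !mul0r subrr mulr0; apply => [t||t].
    + derive_by idtac.
      by rewrite /f (exprS _ n.+1) exprS; field; exact: n0.
    + by apply: is_derive_continuous => t; rewrite /f; derivs.
    + rewrite (le_trans (ler_normD _ _))// lerD//.
        by rewrite nrm ?N1 ?sin_norm1 ?cos_norm1.
      rewrite normrM ler_piMr// mul_norm_le1 ?sin_exp_norm1 ?cos_norm1//.
  move: H0; rewrite Rintegral_add; last 2 first.
  + exact: bm_sin.
  + by apply: bounded_measurable_mul (bm_cos _ _); exact: bounded_measurable_cst.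
  rewrite Rintegral_scale// => /eqP; rewrite addr_eq0 => /eqP h.
  rewrite /suspended_profile1 h /suspended_profile_div; field; exact: n0.
- exists `|J 0| => x; split; rewrite normrM ler_piMr//.
    rewrite -[leRHS]mulr1 -[X in 1 * X](angle_measureT K); apply: normr_Rintegral_le => [|t].
      by case: (bm_cos n x).
    by rewrite mul_norm_le1 ?sin_exp_norm1 ?cos_norm1.
  rewrite -[leRHS]mulr1 -[X in 1 * X](angle_measureT K); apply: normr_Rintegral_le => [|t].
    by case: (bm_sin n x).
  by rewrite nrm ?N1 ?sin_norm1 ?cos_norm1.
- rewrite /suspended_profile mulr_gt0//.
  under eq_Rintegral do rewrite mul0r cos0 mulr1.
  exact: angle_sin_exp_gt0.
Qed.

Let bm_rot c x y : bounded_measurable (fun t : measurableTypeR K =>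
  sin t ^+ n * (cos (x * cos t + c) * J (y * sin t))).
Proof.
apply: bounded_measurable_mul; first exact: bounded_measurable_sin_exp.
apply: bounded_measurable_mul; first exact: bounded_measurable_cos_lin.
have [M JM] := profile_bounded prof.
split; last by exists M => t; have [] := JM (y * sin t).
apply: continuous_measurable_fun.
apply: is_derive_continuous => t.
apply: (deriv_comp (g := J) (f := fun t => y * sin t)); first exact: profile_deriv prof _.
Qed.

(* The integrand of the [phi]-derivative is the [t]-derivative of
   [- sin (a cos t + c) J'(b sin t) (sin t)^n] for [(a, b) = rho (cos phi, sin phi)],
   by the Bessel equation for [J]. *)
Lemma rotation_invariance c rho phi psi :
  \int[U]_t (sin t ^+ n * (cos (rho * cos phi * cos t + c) * J (rho * sin phi * sin t))) =
  \int[U]_t (sin t ^+ n * (cos (rho * cos psi * cos t + c) * J (rho * sin psi * sin t))).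
Proof.
have [M JM] := profile_bounded prof.
have dJ (g : K -> K) b (t : K) : is_derive t 1 g b ->
    is_derive t 1 (fun t => J (g t)) (J1 (g t) * b).
  by move=> dg; apply: deriv_comp dg; exact: profile_deriv prof _.
have dJ1 (g : K -> K) b (t : K) : is_derive t 1 g b ->
    is_derive t 1 (fun t => J1 (g t)) ((- J (g t) - n%:R * H (g t)) * b).
  by move=> dg; apply: deriv_comp dg; exact: profile_deriv1 prof _.
have dJt x (t : K) : is_derive t 1 (fun t => J (rho * sin x * sin t))
    (J1 (rho * sin x * sin t) * (rho * sin x * cos t)).
  by apply: (dJ (fun t => rho * sin x * sin t)); derive_by ring.
have dJ1t x (t : K) : is_derive t 1 (fun t => J1 (rho * sin x * sin t))
    ((- J (rho * sin x * sin t) - n%:R * H (rho * sin x * sin t)) * (rho * sin x * cos t)).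
  by apply: (dJ1 (fun t => rho * sin x * sin t)); derive_by ring.
pose h x := \int[U]_t (sin t ^+ n * (cos (rho * cos x * cos t + c) * J (rho * sin x * sin t))).
pose f' x t := sin t ^+ n *
  (rho * sin x * cos t * sin (rho * cos x * cos t + c) * J (rho * sin x * sin t) +
   cos (rho * cos x * cos t + c) * (J1 (rho * sin x * sin t) * (rho * cos x * sin t))).
have M0 : 0 <= M by have [+ _] := JM 0; exact: le_trans.
have f'M x t : `|f' x t| <= `|rho| * (M + M).
  rewrite /f' normrM; apply: (le_trans (ler_piMl _ (sin_exp_norm1 _ _))) => //.
  have [jm j1m] := JM (rho * sin x * sin t).
  have -> : rho * sin x * cos t * sin (rho * cos x * cos t + c) * J (rho * sin x * sin t) =
      rho * J (rho * sin x * sin t) * (sin x * cos t * sin (rho * cos x * cos t + c)) by ring.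
  have -> : cos (rho * cos x * cos t + c) * (J1 (rho * sin x * sin t) * (rho * cos x * sin t)) =
      rho * J1 (rho * sin x * sin t) * (cos (rho * cos x * cos t + c) * (cos x * sin t)) by ring.
  have bnd (j v : K) : `|j| <= M -> `|v| <= 1 -> `|rho * j * v| <= `|rho| * M.
    by move=> jM v1; rewrite 2!normrM -[leRHS]mulr1 ler_pM// ?mulr_ge0// ler_pM.
  rewrite (le_trans (ler_normD _ _))// mulrDr lerD// bnd// !mul_norm_le1// ?sin_norm1 ?cos_norm1//.
have dh x : is_derive x 1 h (\int[U]_t f' x t).
  apply: (is_derive_Rintegral U
    (f := fun x t => sin t ^+ n * (cos (rho * cos x * cos t + c) * J (rho * sin x * sin t)))
    (M := `|rho| * (M + M))).
  - by move=> y; exact: bm_rot.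
  - move=> y t.
    have dd : is_derive y 1 (fun y => J (rho * sin y * sin t))
        (J1 (rho * sin y * sin t) * (rho * cos y * sin t)).
      by apply: (dJ (fun y => rho * sin y * sin t)); derive_by ring.
    by rewrite /f'; derive_by ring.
  - exact: f'M.
have h0 x : \int[U]_t f' x t = 0.
  have := @angle_FTC K (fun t => - (sin (rho * cos x * cos t + c) *
    J1 (rho * sin x * sin t) * sin t ^+ n)) (f' x) _ _ _ (f'M x).
  (* The boundary terms vanish because [J1 0 = 0 * H 0]; this covers [n = 0], where [(sin t)^n] is 1
     at the endpoints. *)
  rewrite sinpi sin0 !mulr0 (profile_div prof) !mul0r !mulr0 mul0r subrr mulr0; apply => [t|].
    have d1 := dJ1t x t; derive_by idtac.
    rewrite /f' (profile_div prof) /=; case: (n) => [|k] /=.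
      by rewrite !expr0; ring.
    by rewrite exprS; ring.
  apply: is_derive_continuous => t.
  by have d1 := dJt x t; have d2 := dJ1t x t; rewrite /f'; derivs.
apply: (@is_derive_0_is_cst K h) => x; rewrite -(h0 x); exact: dh.
Qed.
End suspension.

(** The angle is [acos (a / rho)], which lies in [[0, pi]], where the sine is nonnegative like
    [b]. *)
Lemma polar_coordinates (K : realType) (a b : K) : 0 <= b ->
  exists phi, a = Num.sqrt (a ^+ 2 + b ^+ 2) * cos phi /\
              b = Num.sqrt (a ^+ 2 + b ^+ 2) * sin phi.
Proof.
move=> b0; set rho := Num.sqrt _.
have s0 : 0 <= a ^+ 2 + b ^+ 2 by rewrite addr_ge0 ?sqr_ge0.
have rho2 : rho ^+ 2 = a ^+ 2 + b ^+ 2 by rewrite sqr_sqrtr.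
have rho0 : 0 <= rho by exact: sqrtr_ge0.
have [r0|r0] := eqVneq rho 0.
  move: rho2; rewrite r0 expr0n /= => /esym/eqP.
  rewrite paddr_eq0 ?sqr_ge0// !sqrf_eq0 => /andP[/eqP -> /eqP ->].
  by exists 0; rewrite !mul0r.
have rp : 0 < rho by rewrite lt_def r0.
have ar : -1 <= a / rho <= 1.
  rewrite -ler_norml normrM normfV (gtr0_norm rp) ler_pdivrMr// mul1r.
  by rewrite -[`|a|]sqrtr_sqr ler_wsqrtr// lerDl sqr_ge0.
exists (acos (a / rho)); rewrite acosK ?in_itv//= sin_acos//.
rewrite mulrC divfK//; split => //.
have -> : 1 - (a / rho) ^+ 2 = (b / rho) ^+ 2.
  by rewrite !expr_div_n rho2; field; rewrite -rho2 expf_neq0.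
by rewrite sqrtr_sqr ger0_norm ?divr_ge0// mulrC divfK.
Qed.

(** Write [(a, b) = rho (cos phi, sin phi)]. Rotating to the angle [pi / 2] removes [cos t] from the
    phase and factors out [cos c]. The remaining integral is identified with [suspended_profile] by
    the same identity at [c = 0] and angle 0. *)
Lemma suspension_transform (K : realType) (n : nat) (J J1 H : K -> K) (a b c : K) :
  radial_profile n J J1 H -> 0 <= b ->
  \int[angle_measure K]_t (sin t ^+ n * (cos (a * cos t + c) * J (b * sin t))) =
  suspended_profile n J (Num.sqrt (a ^+ 2 + b ^+ 2)) * cos c.
Proof.
move=> prof b0; have [phi [aE bE]] := polar_coordinates a b0.
move: (Num.sqrt _) aE bE => rho -> ->.
have bmJ : bounded_measurable (fun t : measurableTypeR K => sin t ^+ n * J (rho * sin t)).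
  have [M JM] := profile_bounded prof.
  apply: bounded_measurable_mul; first exact: bounded_measurable_sin_exp.
  split; last by exists M => t; have [] := JM (rho * sin t).
  apply: continuous_measurable_fun; apply: is_derive_continuous => t.
  by apply: (deriv_comp (g := J) (f := fun t => rho * sin t)); first exact: profile_deriv prof _.
have half c' psi : \int[angle_measure K]_t
    (sin t ^+ n * (cos (rho * cos psi * cos t + c') * J (rho * sin psi * sin t))) =
    cos c' * \int[angle_measure K]_t (sin t ^+ n * J (rho * sin t)).
  rewrite (rotation_invariance prof _ _ _ (pi / 2)) cos_pihalf sin_pihalf.
  rewrite -Rintegral_scale//; apply: eq_Rintegral => t _.
  by rewrite mulr0 mul0r add0r mulr1 mulrCA.
rewrite half mulrC; congr (_ * _).
have := half 0 0; rewrite cos0 mul1r => <-.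
rewrite /suspended_profile -Rintegral_scale.
  by apply: eq_Rintegral => t _; rewrite sin0 mulr0 mul0r mulr1 addr0; ring.
apply: bounded_measurable_mul; first exact: bounded_measurable_sin_exp.
by have := bounded_measurable_cos_lin rho 0; under eq_fun do rewrite addr0.
Qed.

(** * Euclidean geometry and construction of the sphere measures *)

Section euclidean.
Variables (K : realType) (n : nat).
Implicit Types x y : 'rV[K]_n.

Lemma dotp_ge0 x : 0 <= dotp x x.
Proof. by apply: sumr_ge0 => i _; rewrite -expr2 sqr_ge0. Qed.

Lemma dotpZl (c : K) x y : dotp (c *: x) y = c * dotp x y.
Proof. by rewrite /dotp mulr_sumr; apply: eq_bigr => i _; rewrite mxE mulrA. Qed.

Lemma dotpZr (c : K) x y : dotp x (c *: y) = c * dotp x y.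
Proof. by rewrite /dotp mulr_sumr; apply: eq_bigr => i _; rewrite mxE mulrCA. Qed.

Lemma enorm_ge0 x : 0 <= enorm x. Proof. exact: sqrtr_ge0. Qed.

Lemma enormZ (c : K) x : enorm (c *: x) = `|c| * enorm x.
Proof.
by rewrite /enorm dotpZl dotpZr mulrA -expr2 sqrtrM ?sqr_ge0// sqrtr_sqr.
Qed.

Lemma enorm_sqr x : enorm x ^+ 2 = dotp x x.
Proof. by rewrite sqr_sqrtr// dotp_ge0. Qed.

Lemma unit_sphereE x : unit_sphere x <-> dotp x x = 1.
Proof.
rewrite -enorm_sqr /unit_sphere /=; split => [->|/eqP]; first by rewrite expr1n.
by rewrite sqrf_eq1 => /orP[/eqP//|/eqP h]; have := enorm_ge0 x; rewrite h; lra.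
Qed.

Lemma measurable_dotp d (T : measurableType d) (F G : T -> 'rV[K]_n) :
  (forall i, measurable_fun setT (fun t => F t 0 i)) ->
  (forall i, measurable_fun setT (fun t => G t 0 i)) ->
  measurable_fun setT (fun t => dotp (F t) (G t)).
Proof.
by move=> mF mG; apply: measurable_sum => i; exact: measurable_funM.
Qed.

Lemma measurable_dotpl y : measurable_fun setT (fun x : borel_rV K n => dotp x y).
Proof.
by apply: (@measurable_dotp _ (borel_rV K n) id (cst y)) => i //; exact: coord_measurable.
Qed.

Lemma continuous_dotp : continuous (fun x : 'rV[K]_n => dotp x x).
Proof.
rewrite /dotp; elim: (index_enum _) => [|i r IH].
  rewrite (_ : (fun _ => _) = cst 0); first exact: cst_continuous.
  by apply/funext => x; rewrite big_nil.
rewrite (_ : (fun _ => _) = fun x : 'rV[K]_n => x 0 i * x 0 i + \sum_(j <- r) x 0 j * x 0 j).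
  move=> x; apply: (@continuousD K K^o 'rV[K]_n (fun x => x 0 i * x 0 i)); last exact: IH.
  by apply: (@continuousM K 'rV[K]_n (fun x => x 0 i)); exact: coord_continuous.
by apply/funext => x; rewrite big_cons.
Qed.

Lemma closed_unit_sphere : closed (@unit_sphere K n).
Proof.
rewrite (_ : @unit_sphere K n = (fun x => dotp x x) @^-1` [set 1]).
  by apply: closed_comp; [move=> x _; exact: continuous_dotp|exact: closed_eq].
by apply/seteqP; split => x /= /unit_sphereE.
Qed.

Lemma coord_le_enorm x i : `|x 0 i| <= enorm x.
Proof.
rewrite -sqrtr_sqr ler_wsqrtr// /dotp (bigD1 i)//= -expr2 lerDl sumr_ge0//.
by move=> j _; rewrite -expr2 sqr_ge0.
Qed.

Lemma compact_unit_sphere : compact (@unit_sphere K n).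
Proof.
apply: subclosed_compact closed_unit_sphere
  (rV_compact (fun=> @segment_compact K (-1) 1)) _.
by move=> x /= x1 i; rewrite in_itv/= -ler_norml -x1; exact: coord_le_enorm.
Qed.

Lemma measurable_unit_sphereC : measurable (~` @unit_sphere K n : set (borel_rV K n)).
Proof.
by apply: sub_sigma_algebra; rewrite /= openC; exact: closed_unit_sphere.
Qed.

End euclidean.

(** The phase [c] packs both transforms into one identity: [c = 0] gives the radial cosine
    transform, [c = - pi / 2] the vanishing of the sine transform. It also absorbs the axial part of
    the frequency in the suspension step. *)
Definition sphere_measure_spec (K : realType) (n : nat)
    (sigma : borel_measure K n.+1) (J : K -> K) :=
  sigma (~` @unit_sphere K n.+1) = 0%E /\
  forall (xi : 'rV[K]_n.+1) c,
    \int[sigma]_y cos (dotp y xi + c) = J (enorm xi) * cos c.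

Section point_pair.
Variables (K : realType).

Lemma two_point_measure_ex d (T : measurableType d) (x y : T) :
  exists nu : {finite_measure set T -> \bar K},
    forall f, bounded_measurable f -> \int[nu]_z f z = f x + f y.
Proof.
pose m := measure_add (@dirac _ T x K) (@dirac _ T y K).
have fin : fin_num_fun m.
  apply: lty_fin_num_fun.
  apply: (eq_ind_r (fun z => (z < +oo)%E) _ (measure_addE (dirac x) (dirac y) setT)).
  by apply: lte_add_pinfty; exact: ltry.
pose H := Measure_isFinite.Build _ _ _ m fin.
pose nu : {finite_measure set T -> \bar K} :=
  HB.pack_for (FiniteMeasure.type T K) (Measure.sort m) H.
exists nu => f bf; have [mf _] := bf.
rewrite /Rintegral (integral_measure_add (m1 := dirac x) (m2 := dirac y))//; last 2 first.
- exact: (bounded_measurable_integrable (dirac x)).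
- exact: (bounded_measurable_integrable (dirac y)).
by rewrite !integral_dirac ?diracT ?mul1e//; exact/measurable_EFinP.
Qed.

(** The sphere of the line is the pair of points 1 and -1, with unit masses. Its transform [2 cos]
    solves the equation for [n = 0]. *)
Lemma sphere_measure0 : exists (sigma : borel_measure K 1) (J J1 H : K -> K),
  radial_profile 0 J J1 H /\ sphere_measure_spec sigma J.
Proof.
pose e : 'rV[K]_1 := \row_i 1.
have dote c : dotp (c *: e) (c *: e) = c * c by rewrite /dotp big_ord1 !mxE mulr1.
have [sigma sE] := two_point_measure_ex (1 *: e : borel_rV K 1) (-1 *: e : borel_rV K 1).
pose J x : K := 2 * cos x; pose J1 x : K := - 2 * sin x.
(* At 0 the quotient takes the default value 0, consistent with [J1 0 = 0]. *)
exists sigma, J, J1, (fun x => J1 x / x).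
split; [split|split].
- by move=> x; rewrite /J /J1; derive_by ring.
- by move=> x; rewrite /J /J1 mul0r subr0; derive_by ring.
- move=> x; have [->|x0] := eqVneq x 0; first by rewrite mul0r /J1 sin0 mulr0.
  by rewrite mulrC divfK.
- exists 2 => x; rewrite /J /J1 !normrM normrN ger0_norm//.
  by rewrite !ler_piMr ?cos_norm1 ?sin_norm1.
- by rewrite /J cos0 mulr1.
- apply: Rintegral_indicator_eq0; first exact: measurable_unit_sphereC.
  rewrite sE; last exact: (bounded_measurable_indic K (@measurable_unit_sphereC K 1)).
  have nin c : c * c = 1 -> \1_(~` @unit_sphere K 1) (c *: e) = 0 :> K.
    move=> c1; rewrite indicE memNset//= => h.
    by apply: h; apply/unit_sphereE; rewrite dote.
  by rewrite !nin ?addr0//; ring.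
- move=> xi c; rewrite sE; last first.
    by apply: bounded_measurable_cos; apply: measurable_funD => //; exact: measurable_dotpl.
  rewrite !dotpZl mul1r mulN1r !cosD cosN sinN /J.
  have -> : dotp e xi = xi 0 0 by rewrite /dotp big_ord1 mxE mul1r.
  have -> : cos (enorm xi) = cos (xi 0 0).
    by rewrite /enorm /dotp big_ord1 -expr2 sqrtr_sqr; case: ler0P => _ //; rewrite cosN.
  by ring.
Qed.

End point_pair.

Section sphere_step.
Variables (K : realType) (n : nat).

Definition suspend (t : K) (y : 'rV[K]_n.+1) : 'rV[K]_n.+2 :=
  \row_i (if unlift ord0 i is Some j then sin t * y 0 j else cos t).

Lemma dotp_suspend t y xi :
  dotp (suspend t y) xi =
  cos t * xi 0 0 + dotp y (sin t *: \row_j xi 0 (lift ord0 j)).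
Proof.
rewrite dotpZr /dotp big_ord_recl mxE unlift_none; congr (_ + _).
by rewrite mulr_sumr; apply: eq_bigr => j _; rewrite !mxE liftK mulrA.
Qed.

Lemma suspend_unit_sphere t y : unit_sphere y -> unit_sphere (suspend t y).
Proof.
move=> /unit_sphereE y1; apply/unit_sphereE.
rewrite dotp_suspend mxE unlift_none.
rewrite (_ : \row_j _ = sin t *: y); last by apply/rowP => j; rewrite !mxE liftK.
by rewrite !dotpZr y1 mulr1 -!expr2 cos2Dsin2.
Qed.

Lemma measurable_suspend i : measurable_fun [set: measurableTypeR K * borel_rV K n.+1]
  (fun z => suspend z.1 z.2 0 i).
Proof.
rewrite /suspend; under eq_fun do rewrite mxE.
case: unlift => [j|].
  apply: measurable_funM.
    exact: measurableT_comp (@measurable_sin_angle K) measurable_fst.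
  exact: measurableT_comp (@coord_measurable K n.+1 j) measurable_snd.
exact: measurableT_comp (@measurable_cos_angle K) measurable_fst.
Qed.

(** For fixed [t], the inner integral is the transform of [sigma] at [sin t] times the last
    coordinates of [xi], with phase [xi_0 cos t + c]. The outer integral is then the one of
    [suspension_transform]. *)
Lemma sphere_measureS (sigma : borel_measure K n.+1) (J J1 H : K -> K) :
  radial_profile n J J1 H -> sphere_measure_spec sigma J ->
  exists sigma' : borel_measure K n.+2,
    sphere_measure_spec sigma' (suspended_profile n J).
Proof.
move=> prof [sigma0 sigmaE].
(* A mixture weight must be nonnegative on the whole line; on [[0, pi]], which carries the angle
   measure, the absolute value changes nothing. *)
have bw : bounded_measurable (fun t : measurableTypeR K => `|sin t ^+ n|).
  by apply: bounded_measurable_norm; exact: bounded_measurable_sin_exp.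
have [nu nuE] := mixture_ex (angle_measure K) sigma (fun t => normr_ge0 _) bw measurable_suspend.
exists nu; split.
  have mS := @measurable_unit_sphereC K n.+2.
  apply: Rintegral_indicator_eq0 => //.
  have bS := bounded_measurable_indic K mS.
  have [_ ->] := nuE _ bS.
  rewrite -[RHS](mul0r (fine (angle_measure K setT))) -Rintegral_constant.
  apply: eq_Rintegral => t _; rewrite -[RHS](mulr0 `|sin t ^+ n|); congr (_ * _).
  rewrite -[RHS](mul0r (fine (sigma setT))) -Rintegral_constant.
  apply: (Rintegral_null _ _ (@measurable_unit_sphereC K n.+1) sigma0).
  - have mF : measurable_fun setT (suspend t : borel_rV K n.+1 -> borel_rV K n.+2).
      apply: measurable_rV => i.
      exact: measurableT_comp (measurable_suspend i) (pair1_measurable t).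
    exact: (bounded_measurable_comp mF bS).
  - exact: bounded_measurable_cst.
  - move=> y /contrapT /(suspend_unit_sphere t) sy.
    by rewrite indicE memNset//= => /(_ sy).
move=> xi c.
have bc : bounded_measurable (fun y : borel_rV K n.+2 => cos (dotp y xi + c)).
  by apply: bounded_measurable_cos; apply: measurable_funD => //; exact: measurable_dotpl.
have [bI ->] := nuE _ bc.
pose eta : 'rV[K]_n.+1 := \row_j xi 0 (lift ord0 j).
have IE t : \int[sigma]_y cos (dotp (suspend t y) xi + c) =
    J (`|sin t| * enorm eta) * cos (xi 0 0 * cos t + c).
  rewrite -enormZ -sigmaE; apply: eq_Rintegral => y _.
  by rewrite dotp_suspend; congr cos; rewrite /eta; ring.
have -> : enorm xi = Num.sqrt (xi 0 0 ^+ 2 + enorm eta ^+ 2).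
  rewrite enorm_sqr /enorm /dotp big_ord_recl -expr2; congr (Num.sqrt (_ + _)).
  by apply: eq_bigr => j _; rewrite mxE.
rewrite -(suspension_transform _ _ prof) ?enorm_ge0//.
apply: eq_angle_Rintegral.
- exact: bounded_measurable_mul.
- apply: bounded_measurable_mul; first exact: bounded_measurable_sin_exp.
  apply: bounded_measurable_mul; first exact: bounded_measurable_cos_lin.
  have [M JM] := profile_bounded prof.
  split; last by exists M => t; have [] := JM (enorm eta * sin t).
  apply: continuous_measurable_fun; apply: is_derive_continuous => t.
  by apply: (deriv_comp (g := J) (f := fun t => enorm eta * sin t));
    first exact: profile_deriv prof _.
- move=> t tpi; have st : 0 <= sin t by rewrite sin_ge0_pi// in_itv.
  by rewrite IE !ger0_norm ?exprn_ge0// [_ * cos _]mulrC [sin t * _]mulrC.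
Qed.

End sphere_step.

Lemma sphere_measure_ex (K : realType) (n : nat) :
  exists (sigma : borel_measure K n.+1) (J J1 H : K -> K),
    radial_profile n J J1 H /\ sphere_measure_spec sigma J.
Proof.
elim: n => [|n [sigma [J [J1 [H [prof spec]]]]]]; first exact: sphere_measure0.
have [nu nuE] := sphere_measureS prof spec.
exists nu, (suspended_profile n J), (suspended_profile1 n J), (suspended_profile_div n J).
by split => //; exact: suspended_profileP prof.
Qed.

(** * Asymptotics of radial profiles *)

Lemma deriv_powR (K : realType) (alpha x : K) : 0 < x ->
  is_derive x 1 (fun x => x `^ alpha) (alpha * x `^ alpha / x).
Proof.
move=> x0; apply: deriv_eq; first exact: is_derive1_powR.
by rewrite powRB ?(gt_eqF x0) ?implybT// powRr1 ?mulrA// ltW.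
Qed.

Lemma profile_asymptotics (K : realType) (n : nat) (J J1 H : K -> K) :
  radial_profile n J J1 H ->
  exists a A B C, [/\ 0 < a, 0 <= C, (A != 0) || (B != 0) &
    forall x, a <= x ->
      `|x `^ (n%:R / 2) * J x - (A * cos x + B * sin x)| <= C / x].
Proof.
move=> prof; pose alpha : K := n%:R / 2.
(* Since [J 0 > 0], continuity gives a positive starting point with nonzero initial value. *)
have [a a0 Ja] : exists2 a, 0 < a & J a != 0.
  have cJ : J x @[x --> (0:K)^'+] --> J 0.
    by apply: cvg_at_right_filter; apply: (is_derive_continuous (profile_deriv prof)).
  near (0:K)^'+ => a; exists a; first by near: a; exact: nbhs_right_gt.
  rewrite gt_eqF//; near: a; apply: (cvgr_gt _ cJ); exact: profile_gt0 prof.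
(* With [alpha = n / 2] the first-order term of the Bessel equation cancels, leaving the potential
   [alpha (alpha - 1) / x^2]. *)
have [|x ax|x ax|A [B [C [C0 AB HC]]]] := @oscillation_asymptotics K (alpha * (alpha - 1)) a
  (fun x => x `^ alpha * J x) (fun x => x `^ alpha * (J1 x + alpha * J x / x)) a0.
- by rewrite mulf_neq0// gt_eqF// powR_gt0.
- have x0 := lt_le_trans a0 ax; have xn0 : x != 0 by rewrite gt_eqF.
  have d1 := deriv_powR alpha x0; have d2 := profile_deriv prof x.
  by derive_by ring.
- have x0 := lt_le_trans a0 ax; have xn0 : x != 0 by rewrite gt_eqF.
  have d1 := deriv_powR alpha x0; have d2 := profile_deriv prof x.
  have d3 := profile_deriv1 prof x.
  derive_by idtac.
  have -> : n%:R = 2 * alpha by rewrite /alpha; field.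
  rewrite (profile_div prof); move: (x `^ alpha) (alpha) => p al; field; exact: xn0.
by exists a, A, B, C.
Unshelve. all: by end_near. Qed.

(** By periodicity any point can be moved beyond [x0], so the expression is 0 everywhere; the points
    0 and [pi / 2] isolate [A] and [B]. *)
Lemma oscillation_small_eq0 (K : realType) (A B : K) :
  (forall e, 0 < e -> exists x0, forall x, x0 <= x -> `|A * cos x + B * sin x| <= e) ->
  A = 0 /\ B = 0.
Proof.
move=> H.
have bnd v e : 0 < e -> `|A * cos v + B * sin v| <= e.
  move=> /H[x0 hx]; pose k := Num.Def.archi_bound `|x0 - v|.
  rewrite -(periodicn (@cosD2pi K) k v) -(periodicn (@sinD2pi K) k v); apply: hx.
  rewrite -lerBlDl (le_trans (ler_norm _))// (le_trans (ltW (archi_boundP _)))//.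
  by rewrite -/k -[leRHS]mulr_natr ler_peMl// mulr2n; have := @pi_ge2 K; lra.
have eq0 (c : K) : (forall e, 0 < e -> `|c| <= e) -> c = 0.
  move=> ce; apply/eqP; apply: contraT => c0; have := ce (`|c| / 2).
  by rewrite divr_gt0 ?normr_gt0// => /(_ isT); have := normr_gt0 c; rewrite c0; lra.
split; apply: eq0 => e /bnd h.
  by have := h 0; rewrite cos0 sin0 mulr1 mulr0 addr0.
by have := h (pi / 2); rewrite cos_pihalf sin_pihalf mulr1 mulr0 add0r.
Qed.

(** * Fourier decay *)

Section fourier.
Variables (K : realType) (n : nat).
Implicit Types (mu : borel_measure K n) (xi : 'rV[K]_n).

Definition cos_transform mu xi := \int[mu]_x cos (2 * pi * dotp x xi).
Definition sin_transform mu xi := \int[mu]_x sin (2 * pi * dotp x xi).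

Lemma measurable_scaled_dotp (c : K) xi :
  measurable_fun setT (fun x : borel_rV K n => c * dotp x xi).
Proof. by apply: measurable_funM => //; exact: measurable_dotpl. Qed.

Lemma cos_transform_le mu xi : `|cos_transform mu xi| <= fine (mu setT).
Proof.
rewrite -[leRHS]mul1r; apply: normr_Rintegral_le => [|x]; last exact: cos_norm1.
by have [] := bounded_measurable_cos (measurable_scaled_dotp (2 * pi) xi).
Qed.

Lemma sin_transform_le mu xi : `|sin_transform mu xi| <= fine (mu setT).
Proof.
rewrite -[leRHS]mul1r; apply: normr_Rintegral_le => [|x]; last exact: sin_norm1.
by have [] := bounded_measurable_sin (measurable_scaled_dotp (2 * pi) xi).
Qed.

Lemma normc_fourier_transform mu xi :
  ComplexField.Normc.normc (fourier_transform mu xi) ^+ 2 =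
  cos_transform mu xi ^+ 2 + sin_transform mu xi ^+ 2.
Proof.
rewrite /fourier_transform /cintegral /= sqr_sqrtr ?addr_ge0 ?sqr_ge0//.
congr (_ ^+ 2 + _).
  by apply: eq_Rintegral => x _; rewrite /= cosN.
rewrite /sin_transform -[RHS]sqrrN; congr (_ ^+ 2).
rewrite -mulN1r -Rintegral_scale; last exact: bounded_measurable_sin (measurable_scaled_dotp _ _).
by apply: eq_Rintegral => x _; rewrite /= sinN mulN1r.
Qed.

Lemma powR_half_sqr (t s : K) : 0 <= t -> (t `^ (s / 2)) ^+ 2 = t `^ s.
Proof. by move=> t0; rewrite -powR_mulrn ?powR_ge0// -powRrM divfK. Qed.

(** The quantity whose supremum defines [fourier_decay] is the sum of the squares of the two
    products, so it is bounded exactly when both are. *)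
Lemma fourier_decayP mu s : fourier_decay mu s <->
  exists D, forall xi, `|cos_transform mu xi| * enorm xi `^ (s / 2) <= D /\
                       `|sin_transform mu xi| * enorm xi `^ (s / 2) <= D.
Proof.
have E xi : ComplexField.Normc.normc (fourier_transform mu xi) ^+ 2 * enorm xi `^ s =
   (`|cos_transform mu xi| * enorm xi `^ (s / 2)) ^+ 2 +
   (`|sin_transform mu xi| * enorm xi `^ (s / 2)) ^+ 2.
  rewrite normc_fourier_transform !exprMn !real_normK ?num_real//.
  by rewrite powR_half_sqr ?enorm_ge0// mulrDl.
have ge0 u xi : 0 <= `|u| * enorm xi `^ (s / 2) by rewrite mulr_ge0// powR_ge0.
rewrite /fourier_decay; set S := [set _ | _ in _]; split => [Sfin|[D HD]].
  have Sub xi : ((ComplexField.Normc.normc (fourier_transform mu xi) ^+ 2 *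
      enorm xi `^ s)%:E <= ereal_sup S)%E by apply: ereal_sup_ubound; exists xi.
  have fin : ereal_sup S \is a fin_num.
    rewrite fin_numElt Sfin andbT.
    exact: lt_le_trans (ltNyr _) (Sub 0).
  exists (Num.sqrt (fine (ereal_sup S))) => xi.
  have := Sub xi; rewrite -[X in (_ <= X)%E](fineK fin) lee_fin E => h.
  by split; rewrite -[leLHS]ger0_norm// -sqrtr_sqr ler_wsqrtr// (le_trans _ h)//
    ?lerDl ?lerDr sqr_ge0.
apply: (@le_lt_trans _ _ (D ^+ 2 + D ^+ 2)%:E); last exact: ltry.
apply: ge_ereal_sup => _ [xi _ <-]; rewrite lee_fin E.
by have [h1 h2] := HD xi; rewrite lerD// lerXn2r ?nnegrE// ?(le_trans _ h1)// (le_trans _ h2).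
Qed.

End fourier.

(** * Upper bound for decay exponents on the sphere *)

Lemma powR_decay (K : realType) (D delta e : K) : 0 < delta -> 0 < e -> 0 <= D ->
  exists2 x0, 0 < x0 & forall x, x0 <= x -> D * x `^ (- delta) <= e.
Proof.
move=> d0 e0 D0; have De : 0 <= D / e by rewrite divr_ge0// ltW.
(* The power solves [D x^(-delta) = e] when [D > 0]; adding 1 keeps the threshold positive when
   [D = 0]. *)
exists (1 + (D / e) `^ (delta^-1)) => [|x xx].
  by rewrite ltr_wpDr// powR_ge0.
have x0 : 0 < x by apply: lt_le_trans xx; rewrite ltr_wpDr// powR_ge0.
rewrite powRN ler_pdivrMr ?powR_gt0// mulrC -ler_pdivrMr//.
rewrite -[leLHS]powRr1// -(mulVf (lt0r_neq0 d0)) powRrM.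
apply: ge0_ler_powR => //; rewrite ?nnegrE ?powR_ge0//; try exact: ltW.
by apply: le_trans xx; rewrite lerDr.
Qed.

Lemma carried_by_null (K : realType) (n : nat) (A : set 'rV[K]_n) (mu : borel_measure K n) :
  carried_by A mu -> closed A -> mu (~` A) = 0%E.
Proof.
move=> [_ _ sA] cA; apply/eqP; rewrite -measure_le0 -(msupportC_null mu).
apply: le_measure; rewrite ?inE.
- by apply: sub_sigma_algebra; rewrite /= openC.
- by apply: sub_sigma_algebra; rewrite /= openC; exact: closed_msupport.
- exact: subsetC.
Qed.

Lemma measure_gt0_fine d (T : measurableType d) (K : realType)
  (mu : {finite_measure set T -> \bar K}) : mu setT <> 0%E -> 0 < fine (mu setT).
Proof.
move=> /eqP mu0; rewrite fine_gt0// -ge0_fin_numE// fin_num_measure// andbT.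
by rewrite lt_def mu0 measure_ge0.
Qed.

Lemma sphere_decay_le (K : realType) (n : nat) (mu : borel_measure K n.+1) (s : K) :
  carried_by (@unit_sphere K n.+1) mu -> fourier_decay mu s -> s <= n%:R.
Proof.
move=> muS /fourier_decayP[D HD]; rewrite leNgt; apply/negP => ns.
have [sigma [J [J1 [H [prof [sigma0 sigmaE]]]]]] := sphere_measure_ex K n.
have [a [A [B [C [a0 C0 AB asym]]]]] := profile_asymptotics prof.
have mu0 := carried_by_null muS (@closed_unit_sphere K n.+1).
have mT : 0 < fine (mu setT) by case: muS => /measure_gt0_fine.
set m := fine (mu setT) in mT.
have p0 : 0 < 2 * pi :> K by rewrite mulr_gt0// pi_gt0.
have D0 : 0 <= D by have [+ _] := HD 0; apply: le_trans; rewrite mulr_ge0// powR_ge0.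
have mS := @measurable_unit_sphereC K n.+1.
(* Averaging the transform of [mu] over the sphere of radius [rho] and swapping
   the integrals. *)
have key rho : 0 < rho -> `|J rho| * m <= D * (rho / (2 * pi)) `^ (- (s / 2)) * fine (sigma setT).
  move=> rho0; have t0 : 0 < rho / (2 * pi) by rewrite divr_gt0.
  have bf : bounded_measurable (fun z : borel_rV K n.+1 * borel_rV K n.+1 =>
      cos (rho * dotp z.1 z.2)).
    apply: bounded_measurable_cos; apply: measurable_funM => //; apply: measurable_dotp => i.
      exact: measurableT_comp (@coord_measurable K n.+1 i) measurable_fst.
    exact: measurableT_comp (@coord_measurable K n.+1 i) measurable_snd.
  have := Rintegral_swap mu sigma (f := fun x y => cos (rho * dotp x y)) bf.
  have -> : \int[mu]_x \int[sigma]_y cos (rho * dotp x y) = J rho * m.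
    rewrite -Rintegral_constant; apply: (Rintegral_null _ _ mS mu0).
    - exact: bounded_measurable_Rintegral bf.
    - exact: bounded_measurable_cst.
    - move=> x /contrapT x1; have := sigmaE (rho *: x) 0.
      rewrite cos0 mulr1 enormZ x1 mulr1 gtr0_norm// => <-.
      apply: eq_Rintegral => y _; rewrite addr0 dotpZr; congr (cos (_ * _)).
      by apply: eq_bigr => i _; rewrite mulrC.
  move=> e; rewrite -[m]gtr0_norm// -normrM e.
  have bi : bounded_measurable (fun y : borel_rV K n.+1 => \int[mu]_x cos (rho * dotp x y)).
    have bf' : bounded_measurable (fun z : borel_rV K n.+1 * borel_rV K n.+1 =>
        cos (rho * dotp z.2 z.1)).
      exact: (bounded_measurable_comp (@measurable_swap _ _ _ _) bf).
    exact: bounded_measurable_Rintegral bf'.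
  have b1 : bounded_measurable (\1_(@unit_sphere K n.+1) : borel_rV K n.+1 -> K).
    by apply: bounded_measurable_indic; have := measurableC mS; rewrite setCK.
  have bi1 := bounded_measurable_mul bi b1.
  (* The decay estimate at radius [rho / (2 pi)] concerns unit vectors [y] only; the indicator makes
     the bound hold everywhere, without changing the integral. *)
  rewrite (Rintegral_null bi bi1 mS sigma0); last first.
    by move=> y /contrapT y1; rewrite indicE mem_set ?mulr1.
  apply: normr_Rintegral_le => [|y]; first by case: bi1.
  rewrite indicE; have [y1|ny1] := pselect (@unit_sphere K n.+1 y); last first.
    by rewrite memNset// mulr0 normr0 mulr_ge0// powR_ge0.
  rewrite mem_set// mulr1.
  have [+ _] := HD ((rho / (2 * pi)) *: y); rewrite enormZ y1 mulr1 (gtr0_norm t0).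
  rewrite powRN -ler_pdivlMr ?powR_gt0//.
  rewrite (_ : cos_transform _ _ = \int[mu]_x cos (rho * dotp x y))//.
  rewrite /cos_transform; apply: eq_Rintegral => x _; rewrite dotpZr mulrA; congr (cos (_ * _)).
  by rewrite mulrC divfK// gt_eqF.
have [A0 B0] : A = 0 /\ B = 0; last by move: AB; rewrite A0 B0 eqxx.
apply: oscillation_small_eq0 => e e0.
(* The constant for which [key] reads [|J x| <= E x^(-s/2)]. *)
pose E := D * ((2 * pi)^-1) `^ (- (s / 2)) * fine (sigma setT) / m.
have E0 : 0 <= E by rewrite !mulr_ge0 ?invr_ge0 ?powR_ge0 ?fine_ge0// ltW.
have e2 : 0 < e / 2 by rewrite divr_gt0.
have d0 : 0 < (s - n%:R) / 2 by rewrite divr_gt0// subr_gt0.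
have [x1 x1p Hx1] := powR_decay d0 e2 E0.
have [x2 x2p Hx2] := powR_decay ltr01 e2 C0.
(* Beyond [a] the expansion holds; beyond [x1] and [x2] its main term and its error are each at most
   [e / 2]. *)
exists (Num.max a (Num.max x1 x2)) => x; rewrite !ge_max => /and3P[ax xx1 xx2].
have x0 := lt_le_trans a0 ax.
have h1 : `|x `^ (n%:R / 2) * J x| <= e / 2.
  apply: le_trans (Hx1 _ xx1); rewrite normrM ger0_norm ?powR_ge0//.
  have -> : x `^ (- ((s - n%:R) / 2)) = x `^ (n%:R / 2) * x `^ (- (s / 2)).
    rewrite -powRD; first by congr (_ `^ _); field.
    by rewrite (gt_eqF x0) implybT.
  rewrite mulrCA; apply: ler_wpM2l; first exact: powR_ge0.
  rewrite /E mulrAC ler_pdivlMr//; apply: le_trans (key _ x0) _.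
  rewrite powRM ?invr_ge0 ?(ltW x0) ?(ltW p0)// le_eqVlt; apply/orP; left; apply/eqP.
  rewrite -!mulrA; congr (_ * _); rewrite mulrC -!mulrA; congr (_ * _).
have h2 := asym _ ax; have h3 := Hx2 _ xx2.
move: h3; rewrite powRN powRr1 ?(ltW x0)// => h3.
rewrite (splitr e) -[X in `|X|](subKr (x `^ (n%:R / 2) * J x)).
by rewrite (le_trans (ler_normB _ _))// lerD// (le_trans h2).
Qed.

(** * Radial products and the lift of a measure on [R] *)

Lemma closed_line_set (K : realType) (R : set K) : closed R -> closed (line_set R).
Proof. by move=> cR; apply: closed_comp => // x _; exact: coord_continuous. Qed.

(** The point 0 lies in the open complement of [R], so some ball around 0 misses [R]; its radius is
    the lower bound. *)
Lemma compact_positive_bounds (K : realType) (R : set K) : R !=set0 -> compact R ->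
  R `<=` [set r | 0 < r] ->
  exists r1 r2, [/\ 0 < r1, r1 <= r2 & forall r, R r -> r1 <= r <= r2].
Proof.
move=> [r0 Rr0] cR Rpos.
have clR : closed R by apply: compact_closed cR; exact: norm_hausdorff.
have [M [_ HM]] := compact_bounded cR.
have /nbhs_ballP[e /= e0 eR] : nbhs (0 : K) (~` R).
  apply: open_nbhs_nbhs; split; first exact: closed_openC.
  by move=> /Rpos /=; rewrite ltxx.
have eb r : R r -> e <= r <= M + 1.
  move=> Rr; have rp : 0 < r := Rpos _ Rr; apply/andP; split.
    rewrite leNgt; apply/negP => re; have := eR r; apply => //.
    by rewrite /ball/= sub0r normrN gtr0_norm.
  have := HM (M + 1); rewrite ltrDl ltr01 => /(_ isT r Rr) /=.
  exact: le_trans (ler_norm _).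
exists e, (M + 1); split => //.
by have /andP[h1 h2] := eb _ Rr0; exact: le_trans h2.
Qed.

Lemma compact_radial_product (K : realType) (n : nat) (R : set K) : compact R ->
  compact (radial_product R (@unit_sphere K n)).
Proof.
move=> cR.
rewrite (_ : radial_product _ _ =
   (fun z : K^o * 'rV[K]_n => z.1 *: z.2) @` (R `*` @unit_sphere K n)).
  apply: continuous_compact; last by apply: compact_setX => //; exact: compact_unit_sphere.
  by apply: continuous_subspaceT; exact: scale_continuous.
by apply/seteqP; split => [_ [r Rr [y Sy <-]]|_ [[r y] [/= Rr Sy] <-]];
  [exists (r, y)|exists r => //; exists y].
Qed.

(* The measure is the image of [r^(n/2) mu(dr) sigma(dy)] under [(r, y) |-> r y]: the
   factor [r^(n/2)] cancels the decay of the transform of the sphere of radius [r],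
   leaving the oscillating part of the transform of [mu] itself. *)
Lemma radial_measure_decay (K : realType) (n : nat) (R : set K)
    (mu : borel_measure K 1) (s : K) :
  R !=set0 -> compact R -> R `<=` [set r | 0 < r] -> 0 <= s < 1 ->
  carried_by (line_set R) mu -> fourier_decay mu s ->
  exists2 nu : borel_measure K n.+1,
    carried_by (radial_product R (@unit_sphere K n.+1)) nu &
    fourier_decay nu (s + n%:R).
Proof.
move=> R0 cR Rpos /andP[s0 s1] muR /fourier_decayP[D HD].
have [sigma [J [J1 [H [prof [sigma0 sigmaE]]]]]] := sphere_measure_ex K n.
have [a [A [B [C [a0 C0 _ asym]]]]] := profile_asymptotics prof.
have [r1 [r2 [r1p r12 rR]]] := compact_positive_bounds R0 cR Rpos.
have clR : closed R by apply: compact_closed cR; exact: norm_hausdorff.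
have mu0 := carried_by_null muR (closed_line_set clR).
have mR : measurable (~` line_set R : set (borel_rV K 1)).
  by apply: sub_sigma_algebra; rewrite /= openC; exact: closed_line_set.
have mT : 0 < fine (mu setT) by case: muR => /measure_gt0_fine.
have mS := @measurable_unit_sphereC K n.+1.
set m := fine (mu setT) in mT.
pose alpha : K := n%:R / 2; have alpha0 : 0 <= alpha by rewrite divr_ge0.
(* Clipping to [[r1, r2]] makes the weight bounded above and below on the whole line, while it
   remains [r^alpha] on [R]. *)
pose w (x : borel_rV K 1) : K := Num.max r1 (Num.min (x 0 0) r2) `^ alpha.
have wR x : line_set R x -> w x = x 0 0 `^ alpha.
  by move=> /rR/andP[h1 h2]; rewrite /w (min_idPl h2) (max_idPr h1).
have clip (x : 'rV[K]_1) : r1 <= Num.max r1 (Num.min (x 0 0) r2) <= r2.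
  by rewrite le_max lexx /= ge_max r12 ge_min lexx orbT.
have w_ge x : r1 `^ alpha <= w x.
  have /andP[h _] := clip x.
  by apply: ge0_ler_powR => //; rewrite nnegrE ?(le_trans _ h)// ltW.
have bw : bounded_measurable w.
  split.
    apply: (measurableT_comp (measurable_powR alpha)); apply: measurable_maxr => //.
    by apply: measurable_minr => //; exact: coord_measurable.
  exists (r2 `^ alpha) => x; have /andP[h1 h2] := clip x.
  have c0 := le_trans (ltW r1p) h1.
  rewrite ger0_norm ?powR_ge0//.
  by apply: ge0_ler_powR => //; rewrite nnegrE// (le_trans c0).
have w0 x : 0 <= w x by exact: powR_ge0.
have mF i : measurable_fun setT
    (fun z : borel_rV K 1 * borel_rV K n.+1 => (z.1 0 0 *: z.2 : 'rV[K]_n.+1) 0 i).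
  under eq_fun do rewrite mxE; apply: measurable_funM.
    exact: measurableT_comp (@coord_measurable K 1 0) measurable_fst.
  exact: measurableT_comp (@coord_measurable K n.+1 i) measurable_snd.
have [nu nuE] := mixture_ex (F := fun (x : 'rV[K]_1) y => x 0 0 *: y) mu sigma w0 bw mF.
have cRS : compact (radial_product R (@unit_sphere K n.+1)) by exact: compact_radial_product.
have clRS : closed (radial_product R (@unit_sphere K n.+1)).
  by apply: compact_closed cRS; exact: norm_hausdorff.
(* The mass of [nu] is that of [sigma], namely [J 0], times the integral of [w], which is at least
   [r1^alpha m]. *)
have nuT : 0 < fine (nu setT).
  rewrite -[X in 0 < X]mul1r -Rintegral_constant.
  have [_ ->] := nuE _ (bounded_measurable_cst _ 1).
  rewrite Rintegral_constant mul1r.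
  have sT : 0 < fine (sigma setT).
    have := sigmaE 0 0; rewrite (_ : enorm 0 = 0); last first.
      by rewrite /enorm /dotp big1 ?sqrtr0// => i _; rewrite mxE mul0r.
    rewrite cos0 mulr1; under eq_Rintegral.
      move=> y _; rewrite (_ : dotp y 0 = 0) ?addr0 ?cos0; first over.
      by rewrite /dotp big1// => i _; rewrite mxE mulr0.
    by rewrite Rintegral_constant mul1r => ->; exact: profile_gt0 prof.
  under eq_Rintegral do rewrite mulrC.
  rewrite Rintegral_scale// mulr_gt0//.
  apply: (@lt_le_trans _ _ (\int[mu]_x (r1 `^ alpha))).
    by rewrite Rintegral_constant mulr_gt0// powR_gt0.
  by apply: ler_Rintegral => //; exact: bounded_measurable_cst.
have nu0 : nu (~` radial_product R (@unit_sphere K n.+1)) = 0%E.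
  have mRS : measurable (~` radial_product R (@unit_sphere K n.+1) : set (borel_rV K n.+1)).
    by apply: sub_sigma_algebra; rewrite /= openC.
  apply: Rintegral_indicator_eq0 => //.
  have bS := bounded_measurable_indic K mRS.
  have [bI ->] := nuE _ bS.
  rewrite -[RHS](mul0r (fine (mu setT))) -Rintegral_constant.
  apply: (Rintegral_null _ _ mR mu0).
  - exact: bounded_measurable_mul.
  - exact: bounded_measurable_cst.
  move=> x /contrapT Rx; rewrite -[RHS](mulr0 (w x)); congr (_ * _).
  rewrite -[RHS](mul0r (fine (sigma setT))) -Rintegral_constant.
  apply: (Rintegral_null _ _ mS sigma0).
  - have mFx : measurable_fun setT
        (fun y : borel_rV K n.+1 => x 0 0 *: (y : 'rV[K]_n.+1) : borel_rV K n.+1).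
      apply: measurable_rV => i.
      exact: measurableT_comp (mF i) (pair1_measurable x).
    exact: (bounded_measurable_comp mFx bS).
  - exact: bounded_measurable_cst.
  - move=> y /contrapT Sy; rewrite indicE memNset//= => h.
    by apply: h; exists (x 0 0) => //; exists y.
exists nu.
  apply: carried_by_compact nu0 cRS _ => // h.
  by move: nuT; rewrite h ltxx.
have p0 : 0 < 2 * pi :> K by rewrite mulr_gt0// pi_gt0.
pose h (xi : 'rV[K]_n.+1) (x : borel_rV K 1) := J (enorm ((2 * pi * x 0 0) *: xi)).
(* The transform of [nu] with an arbitrary phase: [c = - pi / 2] kills its sine part and [c = 0]
   gives its cosine part. *)
have bwh xi : bounded_measurable (fun x => w x * h xi x) /\
   forall c, \int[nu]_x cos (2 * pi * dotp x xi + c) = (\int[mu]_x (w x * h xi x)) * cos c.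
  have bc c : bounded_measurable (fun x : borel_rV K n.+1 => cos (2 * pi * dotp x xi + c)).
    by apply: bounded_measurable_cos; apply: measurable_funD => //; exact: measurable_scaled_dotp.
  have inner c (x : 'rV[K]_1) :
      \int[sigma]_y cos (2 * pi * dotp (x 0 0 *: y) xi + c) = h xi x * cos c.
    rewrite -sigmaE; apply: eq_Rintegral => y _.
    by rewrite dotpZl dotpZr mulrA.
  have bh : bounded_measurable (h xi).
    have [bI _] := nuE _ (bc 0); move: bI.
    by under [X in bounded_measurable X -> _]eq_fun do rewrite inner cos0 mulr1.
  have bwh := bounded_measurable_mul bw bh; split => // c.
  have [_ ->] := nuE _ (bc c).
  under eq_Rintegral do rewrite inner mulrA mulrC.
  by rewrite (Rintegral_scale mu (cos c) bwh) mulrC.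
have sin0' xi : sin_transform nu xi = 0.
  have [_ /(_ (- (pi / 2)))] := bwh xi.
  rewrite cosN cos_pihalf mulr0 => <-; apply: eq_Rintegral => x _.
  by rewrite cosD cosN sinN cos_pihalf sin_pihalf mulr0 add0r mulrN1 opprK.
have cosE xi : cos_transform nu xi = \int[mu]_x (w x * h xi x).
  have [_ /(_ 0)] := bwh xi; rewrite cos0 mulr1 => <-.
  by apply: eq_Rintegral => x _; rewrite addr0.
pose e1 : 'rV[K]_1 := \row_i 1.
(* With [T = 2 pi |xi|], the integrand [T^alpha r^alpha J(r T)] is [A cos(r T) + B sin(r T)] up to
   [C / (r T)]. Integrating in [r] gives the transforms of [mu] at the frequency [|xi|]. The
   hypothesis ensures [r T >= a] for every [r] in [R]. *)
have main xi : a <= 2 * pi * enorm xi * r1 ->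
    (2 * pi * enorm xi) `^ alpha * `|cos_transform nu xi| <=
    `|A| * `|cos_transform mu (enorm xi *: e1)| + `|B| * `|sin_transform mu (enorm xi *: e1)|
      + C / (2 * pi * enorm xi * r1) * m.
  move=> axi; set T := 2 * pi * enorm xi in axi *.
  have T0 : 0 < T by rewrite -(pmulr_lgt0 _ r1p) (lt_le_trans a0).
  have dE (x : 'rV[K]_1) : 2 * pi * dotp x (enorm xi *: e1) = x 0 0 * T.
    by rewrite dotpZr /dotp big_ord1 mxE mulr1 /T; ring.
  have bcT : bounded_measurable (fun x : borel_rV K 1 => cos (2 * pi * dotp x (enorm xi *: e1))).
    exact: bounded_measurable_cos (measurable_scaled_dotp _ _).
  have bsT : bounded_measurable (fun x : borel_rV K 1 => sin (2 * pi * dotp x (enorm xi *: e1))).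
    exact: bounded_measurable_sin (measurable_scaled_dotp _ _).
  have bA : bounded_measurable (fun x : borel_rV K 1 => A * cos (2 * pi * dotp x (enorm xi *: e1))).
    by apply: bounded_measurable_mul bcT; exact: bounded_measurable_cst.
  have bB : bounded_measurable (fun x : borel_rV K 1 => B * sin (2 * pi * dotp x (enorm xi *: e1))).
    by apply: bounded_measurable_mul bsT; exact: bounded_measurable_cst.
  have bAB := bounded_measurable_add bA bB.
  have [bh _] := bwh xi.
  have bT : bounded_measurable (fun x => T `^ alpha * (w x * h xi x)).
    by apply: bounded_measurable_mul bh; exact: bounded_measurable_cst.
  have bN : bounded_measurable (fun x : borel_rV K 1 =>
     - 1 * (A * cos (2 * pi * dotp x (enorm xi *: e1)) +
            B * sin (2 * pi * dotp x (enorm xi *: e1)))).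
    by apply: bounded_measurable_mul bAB; exact: bounded_measurable_cst.
  have bD := bounded_measurable_add bT bN.
  have b1 : bounded_measurable (\1_(line_set R) : borel_rV K 1 -> K).
    by apply: bounded_measurable_indic; have := measurableC mR; rewrite setCK.
  have bD1 := bounded_measurable_mul bD b1.
  (* The expansion is available only on [R], so the integrand is first cut off by an indicator, at
     no cost since [mu] lives there. *)
  have err : `|\int[mu]_x (T `^ alpha * (w x * h xi x) +
      - 1 * (A * cos (2 * pi * dotp x (enorm xi *: e1)) +
      B * sin (2 * pi * dotp x (enorm xi *: e1))))| <= C / (T * r1) * m.
    rewrite (Rintegral_null bD bD1 mR mu0); last first.
      by move=> x /contrapT Rx; rewrite indicE mem_set ?mulr1.
    apply: normr_Rintegral_le; first by case: bD1.
    move=> x; rewrite indicE; have [Rx|nRx] := pselect (line_set R x); last first.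
      by rewrite memNset// mulr0 normr0 divr_ge0// mulr_ge0// ltW.
    rewrite mem_set// mulr1 dE wR//.
    have /andP[rx _] := rR _ Rx; have x0 : 0 < x 0 0 by exact: lt_le_trans rx.
    have aT : a <= x 0 0 * T by rewrite (le_trans axi)// mulrC ler_wpM2r// ltW.
    have -> : T `^ alpha * (x 0 0 `^ alpha * h xi x) = (x 0 0 * T) `^ alpha * J (x 0 0 * T).
      rewrite mulrA (mulrC (x 0 0)) (powRM alpha (ltW T0) (ltW x0)).
      rewrite /h enormZ ger0_norm; last by rewrite mulr_ge0// ltW.
      by congr (_ * J _); rewrite /T mulrAC.
    rewrite mulN1r; apply: le_trans (asym _ aT) _.
    apply: ler_wpM2l => //; rewrite lef_pV2 ?posrE ?(mulr_gt0 T0 r1p) ?(mulr_gt0 x0 T0)//.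
    by rewrite mulrC ler_wpM2r// ltW.
  rewrite cosE -[T `^ alpha]ger0_norm ?powR_ge0// -normrM -(Rintegral_scale mu _ bh).
  move: err; rewrite (Rintegral_add mu bT bN) (Rintegral_scale mu _ bAB) (Rintegral_add mu bA bB).
  rewrite (Rintegral_scale mu _ bcT) (Rintegral_scale mu _ bsT).
  rewrite -/(cos_transform mu _) -/(sin_transform mu _) -!normrM.
  move: (\int[mu]_x _) (cos_transform mu _) (sin_transform mu _) => I u v.
  rewrite mulN1r => err; rewrite -[I](subrK (A * u + B * v)) addrC.
  by rewrite (le_trans (ler_normD _ _))// lerD// ler_normD.
apply/fourier_decayP.
(* Beyond [t1] the estimate [main] applies. Up to [t1] the transform is bounded by the mass of [nu],
   which gives the first summand of [N]. *)
pose t1 := Num.max 1 (a / (2 * pi * r1)).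
have t1p : 1 <= t1 by rewrite le_max lexx.
have D0 : 0 <= D by have [+ _] := HD 0; apply: le_trans; rewrite mulr_ge0// powR_ge0.
pose N := fine (nu setT) * t1 `^ ((s + n%:R) / 2) +
  ((2 * pi) `^ alpha)^-1 * (`|A| * D + `|B| * D + C / (2 * pi * r1) * m).
have q0 : 0 <= (`|A| * D + `|B| * D + C / (2 * pi * r1) * m).
  by rewrite !addr_ge0// ?mulr_ge0// ?invr_ge0 ?mulr_ge0// ltW// pi_gt0.
exists N => xi; rewrite sin0' normr0 mul0r.
have N1 : 0 <= ((2 * pi) `^ alpha)^-1 * (`|A| * D + `|B| * D + C / (2 * pi * r1) * m).
  by rewrite mulr_ge0// invr_ge0 powR_ge0.
have N0 : 0 <= N by rewrite addr_ge0// mulr_ge0 ?powR_ge0// ltW.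
split => //; set t := enorm xi; have t0 : 0 <= t := enorm_ge0 xi.
have [tt1|t1t] := leP t t1.
  rewrite /N -[leLHS]addr0 lerD// ler_pM// ?powR_ge0 ?cos_transform_le//.
  by apply: ge0_ler_powR; rewrite ?nnegrE// ?divr_ge0 ?addr_ge0// (le_trans t0).
have t1' : 1 <= t by exact: le_trans (ltW t1t).
have tp : 0 < t by exact: lt_le_trans t1'.
apply: (@le_trans _ _ (((2 * pi) `^ alpha)^-1 *
  (`|A| * D + `|B| * D + C / (2 * pi * r1) * m))); last first.
  by rewrite lerDr mulr_ge0 ?powR_ge0// ltW.
have axi : a <= 2 * pi * t * r1.
  have : a / (2 * pi * r1) <= t by rewrite (le_trans _ (ltW t1t))// le_max lexx orbT.
  by rewrite ler_pdivrMr ?(mulr_gt0 p0 r1p)// mulrA (mulrC t).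
have := main _ axi; rewrite -/t.
have enormt : enorm (t *: e1) = t.
  by rewrite enormZ ger0_norm// /enorm /dotp big_ord1 !mxE mulr1 sqrtr1 mulr1.
have := HD (t *: e1); rewrite enormt => -[hc hs] hm.
rewrite [leRHS]mulrC ler_pdivlMr ?powR_gt0//.
have -> : (s + n%:R) / 2 = alpha + s / 2 by rewrite /alpha; field.
rewrite powRD ?(gt_eqF tp) ?implybT//.
have -> : `|cos_transform nu xi| * (t `^ alpha * t `^ (s / 2)) * (2 * pi) `^ alpha =
    (2 * pi * t) `^ alpha * `|cos_transform nu xi| * t `^ (s / 2).
  by rewrite (powRM alpha (ltW p0) t0); ring.
apply: (le_trans (ler_wpM2r (powR_ge0 _ _) hm)).
(* The error of order [1 / t] is absorbed because [s / 2 <= 1] and [t >= 1]. *)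
have ht : t `^ (s / 2) / t <= 1.
  rewrite ler_pdivrMr// mul1r -[leRHS]powRr1//.
  by apply: ler_powR => //; lra.
rewrite 2!mulrDl; apply: lerD; first by rewrite -2!mulrA lerD// ler_wpM2l.
have -> : C / (2 * pi * t * r1) * m * t `^ (s / 2) =
    C / (2 * pi * r1) * m * (t `^ (s / 2) / t).
  move: (2 * pi : K) (t `^ (s / 2)) p0 => p q p0.
  by field; rewrite !gt_eqF.
by rewrite ler_piMr// !mulr_ge0// ?invr_ge0 ?mulr_ge0// ltW// pi_gt0.
Qed.

(** * Comparison of the dimensions *)

(** A point mass has a bounded transform. It supplies the exponent 0 when [R] admits no positive
    one. *)
Lemma dirac_decay0 (K : realType) (n : nat) (A : set 'rV[K]_n) (x : 'rV[K]_n) :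
  A x -> exists2 mu : borel_measure K n, carried_by A mu & fourier_decay mu 0.
Proof.
move=> Ax; pose mu : borel_measure K n := dirac (x : borel_rV K n).
exists mu.
  apply: (@carried_by_compact _ _ [set x]).
  - by rewrite /mu /= diracT => /eqP; rewrite onee_eq0.
  - by rewrite /mu /= diracE memNset//= => /(_ erefl).
  - exact: compact_set1.
  - by move=> _ ->.
apply/fourier_decayP; exists (fine (mu setT)) => xi.
by rewrite mul0r powRr0 !mulr1; split; [exact: cos_transform_le|exact: sin_transform_le].
Qed.

Unset Implicit Arguments.

Theorem proposition1p4 (K : realType) (d : nat) (hd : (1 <= d)%N)
    (R : set K) (hR0 : R !=set0) (hRc : compact R)
    (hRpos : R `<=` [set r : K | 0 < r]) :
  fourier_dim (radial_product R (@unit_sphere K d)) >=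
  fourier_dim (line_set R) + fourier_dim (@unit_sphere K d).
Proof.
case: d hd => [//|n] _; rewrite /fourier_dim.
set C := (X in _ <= sup X); set A := (X in sup X + _); set B := (X in _ + sup X).
have ubC : has_ubound C by exists n.+1%:R => s [/andP[_ /ltW]].
have C_ge s : C s -> s <= sup C by move=> Cs; exact: ub_le_sup.
(* The value [s = 0] is allowed, although it is excluded from the set defining the dimension of [R];
   positivity is asked of [s + n] instead. *)
have inC (s : K) : 0 <= s < 1 -> 0 < s + n%:R ->
    (exists2 mu : borel_measure K 1, carried_by (line_set R) mu & fourier_decay mu s) ->
    s + n%:R <= sup C.
  move=> s01 sn [mu muR decay]; apply: C_ge; split; last exact: radial_measure_decay decay.
  by rewrite sn/= -natr1 addrC ltrD2l; case/andP: s01.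
have supB : sup B <= n%:R.
  have [->|B0] := eqVneq B set0; first by rewrite sup0 ler0n.
  apply: ge_sup; first exact/set0P.
  by move=> s [_ [mu muS decay]]; exact: sphere_decay_le decay.
apply: (le_trans (lerD (lexx _) supB)).
(* If [R] has positive exponents, each one is lifted and the supremum taken. Otherwise the supremum
   is 0 by convention, and it remains to show [n <= sup C]: for [n > 0] a point mass in [R] is
   lifted, and for [n = 0] the elements of [C] are positive. *)
have [A0|A0] := eqVneq A set0; last first.
  rewrite -lerBrDr; apply: ge_sup; first exact/set0P.
  move=> s [/andP[s0 s1] ex]; rewrite lerBrDr; apply: inC => //.
    by rewrite (ltW s0).
  by rewrite ltr_wpDr.
rewrite A0 sup0; have [n0|n0] := posnP n.
  rewrite n0 addr0; have [->|/set0P[s Cs]] := eqVneq C set0; first by rewrite sup0.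
  by apply: le_trans (C_ge _ Cs); case: Cs => /andP[/ltW].
apply: inC; rewrite ?lexx ?ltr01 ?add0r ?ltr0n//.
have [r Rr] := hR0.
by apply: (@dirac_decay0 _ _ _ (\row_i r)); rewrite /line_set /= mxE.
Qed.
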